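(* Let $\mathfrak q=\mathrm{Lie}\,Q$ be a finite-dimensional quadratic Lie algebra over $\mathbb K$ with $[\mathfrak q,\mathfrak q]\ne0$, where $Q$ is an algebraic group, and let $n\ge2$. (i) For any monic $p\in\mathbb K[t]$ of degree $n$, the subspace $\mathcal P_{\boldsymbol h,p}=\{H\in\langle\boldsymbol h[a,b]\mid 0\le a,b<n\rangle:\{\boldsymbol h,H\}_p=0\}$ has dimension $2n-1$. (ii) If $p=\prod_{i=1}^n(t-a_i)$ with $a_i\ne a_j$ for $i\ne j$, $p(0)\ne0$, and the Gaudin Hamiltonians $\mathcal H_k$ are associated with $\vec z=(a_1^{-1},\dots,a_n^{-1})$, then $\mathcal H_k\in\psi_p(\mathcal Z(\widehat{\mathfrak q},t))$ and $\mathcal H_k\in\mathcal Z(p,p+t)$ for each $k$.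
   Context: $\mathbb K$ is an algebraically closed field of characteristic $0$. $\mathfrak q$ is quadratic: there is a non-degenerate $Q$-invariant symmetric bilinear form on $\mathfrak q$; $\{x_i\}$ is an orthonormal basis of $\mathfrak q$ for it. For monic $p$ of degree $n$, $\mathfrak q[t]/(p)$ is identified, as a vector space, with $\mathbb W=\bigoplus_{k=0}^{n-1}\mathfrak q\bar t^{\,k}$, $\bar t=t+(p)$; the resulting Lie bracket is $[\,,]_p$, the Lie–Poisson bracket on $\mathcal S(\mathbb W)$ is $\{\,,\}_p$ and $\mathcal Z_p$ is its Poisson centre. For monic $p_1\ne p_2$ of degree $n$ with $\deg(p_1-p_2)\le1$, $\mathcal Z(p_1,p_2)\subset\mathcal S(\mathbb W)$ is the subalgebra generated by all $\mathcal Z_{ap_1+(1-a)p_2}$, $a\in\mathbb K$. $\psi_p:\mathcal S(\mathfrak q[t])\to\mathcal S(\mathbb W)$ extends the quotient map $\mathfrak q[t]\to\mathfrak q[t]/(p)$. $\boldsymbol h[a,b]=\sum_ix_i\bar t^{\,a}\,x_i\bar t^{\,b}\in\mathcal S(\mathbb W)$, $\boldsymbol h=\boldsymbol h[1,1]$, and $\boldsymbol h[\bar r,\bar s]=\sum_ix_i\bar r\,x_i\bar s$ for $\bar r,\bar s\in\mathbb K[t]/(p)$. When $p$ has distinct roots $a_1,\dots,a_n$, put $r_i=\frac{p}{t-a_i}\prod_{j\ne i}(a_i-a_j)^{-1}$ and $\bar r_i=r_i+(p)$; then $(\mathbb W,[\,,]_p)=\bigoplus_i\mathfrak q\bar r_i\cong\mathfrak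 q^{\oplus n}$. The Gaudin Hamiltonians associated with $\vec z=(z_1,\dots,z_n)$ (pairwise distinct entries) are $\mathcal H_k=\sum_{j\ne k}\frac{1}{z_k-z_j}\boldsymbol h[\bar r_k,\bar r_j]\in\mathcal S(\mathbb W)$, $1\le k\le n$. $\mathcal Z(\widehat{\mathfrak q},t^{-1})=\mathcal S(t^{-1}\mathfrak q[t^{-1}])^{\mathfrak q[t]}$, where $\mathcal S(t^{-1}\mathfrak q[t^{-1}])$ is regarded as the quotient of $\mathcal S(\mathfrak q[t,t^{-1}])$ by the ideal generated by $\mathfrak q[t]$; $\mathcal Z(\widehat{\mathfrak q},t)\subset\mathcal S(t\mathfrak q[t])$ is its image under $xt^{-k}\mapsto xt^k$. *)

(* Defs.v *)
From HB Require Import structures.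
From mathcomp Require Import all_boot all_order all_algebra.
From mathcomp Require Import finmap.
From mathcomp.multinomials Require Import monalg.

Set Implicit Arguments.
Unset Strict Implicit.
Unset Printing Implicit Defensive.

Import GRing.Theory.
Local Open Scope ring_scope.

HB.mixin Record Vector_isLieAlgebra (K : fieldType) V of Vector K V := {
  lie : V -> V -> V;
  lie_linearl : forall y : V, linear (lie ^~ y);
  lie_linearr : forall y : V, linear (lie y);
  lie_alt : forall y : V, lie y y = 0;
  lie_jacobi : forall y z w : V,
    lie y (lie z w) + lie z (lie w y) + lie w (lie y z) = 0
}.

#[short(type="lieAlgType")]
HB.structure Definition LieAlgebra (K : fieldType) :=
  { V of Vector_isLieAlgebra K V & Vector K V }.

(* If I indexes a basis of a vector space V (possibly of infinite dimension), *)
(* sym K I is the symmetric algebra S(V), i.e., the polynomial algebra        *)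
(* K[I].                                                                      *)
Notation sym K I := {malg K[{cmonom I}]}.

Section SymmetricAlgebra.
Variables (K : fieldType) (I : choiceType).
Implicit Types (F G : sym K I).

Definition svar (v : I) : sym K I := << @ucm I v >>.

(* The algebra morphism K[I] -> A such that v |-> f v. *)
Definition seval (A : comAlgType K) (f : I -> A) F : A :=
  mmap (in_alg A)
    (fun m : {cmonom I} => \prod_(v <- finsupp m) f v ^+ m v) F.

(* The K-linear derivation of K[I] such that v |-> D v. *)
Definition sderiv (D : I -> sym K I) F : sym K I :=
  mmap (in_alg (sym K I))
    (fun m : {cmonom I} =>
       \sum_(v <- finsupp m) (<< divcm m (@ucm I v) >> *+ m v) * D v) F.

(* {F, G} = \sum_(u, v) dF/du dG/dv [u, v] *)
Definition poisson (br : I -> I -> sym K I) F G : sym K I :=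
  sderiv (fun u => sderiv (br u) G) F.

Definition poisson_center (br : I -> I -> sym K I) F : Prop :=
  forall G, poisson br F G = 0.

End SymmetricAlgebra.

Inductive subalg_gen (K : fieldType) (A : comAlgType K) (G : A -> Prop) :
    A -> Prop :=
  | Subalg_gen F of G F : subalg_gen G F
  | Subalg_scalar (c : K) : subalg_gen G c%:A
  | Subalg_add F F' of subalg_gen G F & subalg_gen G F' :
      subalg_gen G (F + F')
  | Subalg_mul F F' of subalg_gen G F & subalg_gen G F' :
      subalg_gen G (F * F').

(* P is a linear subspace of V, of dimension m (V may be infinite             *)
(* dimensional).                                                              *)
Definition has_dim (K : fieldType) (V : lmodType K) (P : V -> Prop) (m : nat) :
    Prop :=
  exists e : 'I_m -> V,
    (forall c : 'I_m -> K, \sum_i c i *: e i = 0 -> forall i, c i = 0) /\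
    (forall v, P v <-> exists c : 'I_m -> K, v = \sum_i c i *: e i).

Section AlgebraicGroup.
Variables (K : fieldType) (N : nat).
Implicit Types (Q : 'M[K]_N -> Prop) (f : sym K ('I_N * 'I_N)%type).

Definition mx_eval f (g : 'M[K]_N) : K :=
  seval (A := K^o) (fun v => g v.1 v.2) f.

Definition mx_diff1 f (X : 'M[K]_N) : K :=
  mx_eval (sderiv (fun v => (X v.1 v.2)%:A) f) 1%:M.

Definition algebraic_group Q : Prop :=
  [/\ exists E : sym K ('I_N * 'I_N)%type -> Prop,
        forall g, Q g <->
          g \in unitmx /\ forall f, E f -> mx_eval f g = 0,
      Q 1%:M,
      forall g h, Q g -> Q h -> Q (g *m h)
    & forall g, Q g -> Q (invmx g)].

(* Lie Q is the tangent space of Q at 1, as a subset of gl_N. *)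
Definition Lie Q (X : 'M[K]_N) : Prop :=
  forall f, (forall g, Q g -> mx_eval f g = 0) -> mx_diff1 f X = 0.

(* iota is an isomorphism of Lie algebras from q to Lie Q. *)
Definition Lie_iso (q : lieAlgType K) Q (iota : {linear q -> 'M[K]_N}) : Prop :=
  [/\ injective iota,
      forall X, Lie Q X <-> exists y, iota y = X
    & forall y z, iota (lie y z) = iota y *m iota z - iota z *m iota y].

(* Invariance under the adjoint action Ad(g) X = g X g^-1 of Q. *)
Definition Ad_invariant (q : lieAlgType K) Q (iota : {linear q -> 'M[K]_N})
    (B : q -> q -> K) : Prop :=
  forall g, Q g -> forall y y' z z' : q,
    iota y' = g *m iota y *m invmx g -> iota z' = g *m iota z *m invmx g ->
    B y' z' = B y z.

End AlgebraicGroup.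

(* In the sequel x is a basis of q. The symmetric algebras of q[t, t^-1],     *)
(* q[t], t^-1 q[t^-1] and W are the polynomial algebras on the x_i t^k, as    *)
(* follows:                                                                   *)
(*   (i, k) : 'I_d * int   stands for x_i t^k in q[t, t^-1],                  *)
(*   (i, k) : 'I_d * nat   stands for x_i t^k in q[t],                        *)
(*   (i, k) : 'I_d * nat   stands for x_i t^(-k-1) in t^-1 q[t^-1],           *)
(*   (i, k) : 'I_d * 'I_n  stands for x_i tbar^k in W.                        *)
Section Currents.
Variables (K : fieldType) (q : lieAlgType K) (d : nat) (x : d.-tuple q).

Notation sym_loop := (sym K ('I_d * int)%type).
Notation sym_cur := (sym K ('I_d * nat)%type).
Notation sym_neg := (sym K ('I_d * nat)%type).

(* The element y t^k, where y : q. *)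
Definition elt (T : choiceType) (y : q) (k : T) : sym K ('I_d * T)%type :=
  \sum_(i < d) coord x i y *: svar K (i, k).

Definition loop_bracket (u v : 'I_d * int) : sym_loop :=
  elt (lie x`_u.1 x`_v.1) (u.2 + v.2).

Definition neg_incl : sym_neg -> sym_loop :=
  seval (fun v : 'I_d * nat => svar K (v.1, Negz v.2)).

(* The quotient of S(q[t, t^-1]) by the ideal generated by q[t]. *)
Definition neg_proj : sym_loop -> sym_neg :=
  seval (fun v : 'I_d * int => if v.2 is Negz k then svar K (v.1, k) else 0).

Definition Zhat_neg (F : sym_neg) : Prop :=
  forall (y : q) (k : nat),
    neg_proj (poisson loop_bracket (elt y (k%:Z)) (neg_incl F)) = 0.

(* The image of Zhat_neg under x t^-k |-> x t^k. *)
Definition Zhat (F : sym_cur) : Prop :=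
  exists2 G : sym_neg, Zhat_neg G & F =
    seval (fun v : 'I_d * nat => svar K (v.1, v.2.+1)) G.

Section Quotient.
Variables (n : nat) (p : {poly K}).

Notation symW := (sym K ('I_d * 'I_n)%type).

(* The class y rbar of y r in q[t]/(p), where p is monic of degree n. *)
Definition barW (y : q) (r : {poly K}) : symW :=
  \sum_(k < n) (r %% p)`_k *: elt y k.

Definition bracketW (u v : 'I_d * 'I_n) : symW :=
  barW (lie x`_u.1 x`_v.1) ('X^(u.2 + v.2)).

Definition Zquot : symW -> Prop := poisson_center bracketW.

Definition psi : sym_cur -> symW := seval (fun v : 'I_d * nat => barW x`_v.1 'X^(v.2)).

Definition hbar (r s : {poly K}) : symW :=
  \sum_(i < d) barW x`_i r * barW x`_i s.

Definition lagrange_basis (a : 'I_n -> K) (i : 'I_n) : {poly K} :=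
  (\prod_(j < n | j != i) (a i - a j))^-1 *: (p %/ ('X - (a i)%:P)).

Definition gaudin (a z : 'I_n -> K) (k : 'I_n) : symW :=
  \sum_(j < n | j != k) (z k - z j)^-1 *: hbar (lagrange_basis a k) (lagrange_basis a j).

End Quotient.

Definition Zpencil (n : nat) (p1 p2 : {poly K}) :
    sym K ('I_d * 'I_n)%type -> Prop :=
  subalg_gen (fun F => exists c : K, Zquot (c *: p1 + (1 - c) *: p2) F).

Definition hmon (n : nat) (a b : 'I_n) : sym K ('I_d * 'I_n)%type :=
  \sum_(i < d) svar K (i, a) * svar K (i, b).

Definition in_span_h (n : nat) (H : sym K ('I_d * 'I_n)%type) : Prop :=
  exists c : 'I_n -> 'I_n -> K, H = \sum_(a < n) \sum_(b < n) c a b *: hmon a b.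

(* The index o1 stands for 1 : 'I_n, so that hmon o1 o1 is h[1, 1]. *)
Definition Ph (n : nat) (o1 : 'I_n) (p : {poly K})
    (H : sym K ('I_d * 'I_n)%type) : Prop :=
  in_span_h H /\ poisson (bracketW (n := n) p) (hmon o1 o1) H = 0.

End Currents.

(* Main.v *)
Require Import Defs.
From HB Require Import structures.
From mathcomp Require Import all_boot all_order all_algebra.
From mathcomp Require Import finmap.
From mathcomp.multinomials Require Import monalg.
From mathcomp Require Import zify ring.

(* (i) The bracket of h with sum S_ab h[a, b] (S symmetric) is the image of    *)
(* the tensor t /\ (x - y) S under an injective map from Lambda^3 (K[t]/(p))  *)
(* to cubic elements, where S is read as a polynomial in x, y, modulo p(x) and *)
(* p(y). It vanishes iff (x - y) S = p(x)g(y) - p(y)g(x) + x f(y) - y f(x) for *)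
(* some f, g of degree < n, where the coefficient f_1 is irrelevant; this      *)
(* leaves n + (n - 1) parameters.                                              *)
(* (ii) The solution S with parameters (g, f) = (g, g) for p is the one with   *)
(* (g, 0) for p + t, and parameters (g, 0) give elements of the centre Z_p, so *)
(* parameters (0, g) give elements of Z(p, p + t). In the Lagrange basis such  *)
(* a solution has coefficients (a_i g(a_j) - a_j g(a_i)) / (a_i - a_j) off the *)
(* diagonal, and a multiple of g = r_k yields H_k up to the central elements   *)
(* h[r_i, r_i]. Likewise the Segal-Sugawara elements sum_(i + j = m + 1) h[i, j] *)
(* have coefficients xy (phi(x) - phi(y)) / (x - y) with phi = t^m; a phi that *)
(* agrees with a multiple of r_k at the a_i and whose derivative vanishes      *)
(* there yields H_k exactly.                                                   *)

Set Implicit Arguments.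
Unset Strict Implicit.
Unset Printing Implicit Defensive.

Import GRing.Theory.
Local Open Scope ring_scope.

(** * Evaluation morphisms on symmetric algebras *)

(** Quadratic elements are encoded by symmetric arrays S of coefficients of the h[a, b], read as
    polynomials in x and y of degree < n in each variable. Invariance of the form under the group
    differentiates to invariance under the Lie algebra ([lie_invariant]), so the structure constants
    [str] in the orthonormal basis are antisymmetric in all three indices. Hence the bracket of x_i
    t^m with [hquad S] multiplies S by y^m - x^m modulo p(x) and p(y) ([sderiv_hquad]), and
    everything depends on (x - y) S.

    If (x - y) S = p(x)g(y) - p(y)g(x), all these brackets vanish and [hquad S] is central
    ([Zquot_hquad]). In the bracket with h only m = 1 occurs, with a further factor x_i t; a summand
    x f(y) - y f(x) of (x - y) S then contributes an alternating cubic expression with two equal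
    arguments, that is, zero ([Ph_sol]). Conversely, evaluation at points built from a nonzero
    structure constant excludes every other remainder ([Ph_hquad]). The pair (g, f) with f_1 = 0 is
    determined by the element ([hquad_inj], [sol_eq0]), which gives dimension n + (n - 1) in
    [dim_Ph].

    For the second part, the array with parameters (f, f) is central for p + t and the one with (f,
    0) is central for p, so their difference lies in Z(p, p + t). In the Lagrange basis the
    coefficients are the values S(a_i, a_j) ([sum_bil_lagrange]); an f vanishing at all roots but
    a_k yields H_k up to Casimir elements ([Zpencil_gaudin]). On the side of the current algebra,
    arrays depending only on b + c give invariants ([Zhat_neg_segal]), and Hermite interpolation at
    the roots selects the one mapped to H_k ([Zhat_gaudin]). *)

Lemma malgUZ (M : choiceType) (R : nzRingType) (c : R) (m : M) :
  << c *g m >> = c *: << m >> :> {malg R[M]}.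
Proof. by apply/malgP=> k; rewrite mcoeffZ !mcoeffU mulrnAr mulr1. Qed.

Lemma malgUM (M : monomType) (R : nzRingType) (m1 m2 : M) :
  << mmul m1 m2 >> = << m1 >> * << m2 >> :> {malg R[M]}.
Proof. by rewrite malgM_def fgmulUU mulr1. Qed.

Section CMonom.
Variables (I : choiceType).
Implicit Types (m : {cmonom I}).

Lemma ucm_divcm m v : m v != 0%N -> mmul (@ucm I v) (divcm m (@ucm I v)) = m.
Proof.
move=> mv; apply/eqP/cmP=> i; rewrite cmM divcmE cmU.
by case: eqP => [<-|]; rewrite ?subn0 // subnKC // lt0n.
Qed.

Lemma cmonom_ind (P : {cmonom I} -> Prop) :
  P mone -> (forall v m, P m -> P (mmul (@ucm I v) m)) -> forall m, P m.
Proof.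
move=> P1 PM m; have [k] := ubnP (mdeg m); elim: k m => // k IH m lt_m.
have [->|m_neq1] := eqVneq m (mone : {cmonom I}); first exact: P1.
have /fset0Pn[v v_in] : finsupp m != fset0.
  apply: contraNneq m_neq1 => m0; apply/eqP/mdeg_eq0I.
  by rewrite mdegE m0 big_seq_fset0.
have mv : m v != 0%N by rewrite cmE_neq0.
rewrite -(ucm_divcm mv); apply/PM/IH.
by move: lt_m; rewrite -[in X in X -> _](ucm_divcm mv) mdegM mdegU.
Qed.

End CMonom.

Section SymTheory.
Variables (K : fieldType) (I : choiceType).
Implicit Types (F G : sym K I).

Lemma sym_ind (P : sym K I -> Prop) :
  (forall c : K, P c%:A) -> (forall v, P (svar K v)) ->
  (forall F G, P F -> P G -> P (F + G)) ->
  (forall F G, P F -> P G -> P (F * G)) -> forall F, P F.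
Proof.
move=> Pc Pv PD PM F; rewrite [F]monalgE.
apply: (big_ind P) => [|//|m _]; first by rewrite -(scale0r 1).
rewrite malgUZ -mulr_algl; apply: (PM); first exact: Pc.
elim/cmonom_ind: m => [|v m IHm]; first by rewrite -[<<_>>]scale1r; apply: Pc.
rewrite malgUM; exact: (PM _ _ (Pv v) IHm).
Qed.

Section Evaluation.
Variables (A : comAlgType K) (f : I -> A).

Definition cmeval (m : {cmonom I}) : A := \prod_(v <- finsupp m) f v ^+ m v.

Lemma cmevalEw (m : {cmonom I}) (d : {fset I}) : (finsupp m `<=` d)%fset ->
  cmeval m = \prod_(v <- d) f v ^+ m v.
Proof.
move=> le; rewrite /cmeval (big_fset_incl _ le) //.
by move=> i i_in_d; rewrite -cmE_neq0 negbK => /eqP->.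
Qed.

Lemma cmeval_multiplicative : mmorphism cmeval.
Proof.
split=> [m1 m2|]; last by rewrite /cmeval mdom1 big_seq_fset0.
rewrite {1}/cmeval mdomD.
rewrite (cmevalEw (fsubsetUl _ (finsupp m2))).
rewrite (cmevalEw (fsubsetUr (finsupp m1) _)) -big_split /=.
by apply: eq_bigr => v _; rewrite cmM exprD.
Qed.

HB.instance Definition _ :=
  isMultiplicative.Build {cmonom I} A cmeval cmeval_multiplicative.

Lemma sevalE F : seval f F = mmap (in_alg A) cmeval F.
Proof. by []. Qed.

Lemma seval_additive : additive (seval f).
Proof. by move=> F G; rewrite !sevalE raddfB. Qed.
HB.instance Definition _ :=
  GRing.isZmodMorphism.Build (sym K I) A (seval f) seval_additive.

Lemma seval_monoid : monoid_morphism (seval f).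
Proof. by split=> [|F G]; rewrite !sevalE ?rmorph1 ?rmorphM. Qed.
HB.instance Definition _ :=
  GRing.isMonoidMorphism.Build (sym K I) A (seval f) seval_monoid.

Lemma seval_scalable : scalable (seval f).
Proof. by move=> c F; rewrite !sevalE mmapZ /= mulr_algl. Qed.
HB.instance Definition _ :=
  GRing.isScalable.Build K (sym K I) A *:%R (seval f) seval_scalable.

Lemma seval_svar v : seval f (svar K v) = f v.
Proof.
by rewrite sevalE mmapU /= scale1r mul1r /cmeval mdomU big_seq_fset1 cmUU.
Qed.

End Evaluation.

Lemma seval_uniq (A : comAlgType K) (f : I -> A) (phi : {lrmorphism sym K I ->
  A}) :
  (forall v, phi (svar K v) = f v) -> phi =1 seval f.
Proof.
move=> phiv F; elim/sym_ind: F => [c|v|F G IHF IHG|F G IHF IHG].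
- by rewrite !linearZ !rmorph1.
- by rewrite phiv seval_svar.
- by rewrite !raddfD /= IHF IHG.
- by rewrite !rmorphM /= IHF IHG.
Qed.

End SymTheory.

(** * Derivations and Poisson brackets *)

Section MonoidAlgebra.
Variables (K : fieldType) (M : conomType) (A : comAlgType K).
Implicit Types (F G : {malg K[M]}).

Lemma mmap_scalable (h : M -> A) : scalable (mmap (in_alg A) h).
Proof.
move=> c F; rewrite (mmapEw (msuppZ_le c F)) mmapE scaler_sumr.
by apply: eq_bigr => m _; rewrite mcoeffZ /= -!scalerAl scalerA.
Qed.

(** The Leibniz rule along [e] is bilinear in the two factors, so it passes from monomials to the
    whole monoid algebra. *)
Lemma mmap_derivation (h e : M -> A) F G :
  (forall m1 m2, h (mmul m1 m2) = h m1 * e m2 + e m1 * h m2) ->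
  mmap (in_alg A) h (F * G)
    = mmap (in_alg A) h F * mmap (in_alg A) e G
      + mmap (in_alg A) e F * mmap (in_alg A) h G.
Proof.
move=> hM; rewrite malgME raddf_sum (mmapE _ h) (mmapE _ e F) !mulr_suml
  -big_split.
apply: eq_bigr => m1 _;
  rewrite raddf_sum (mmapE _ h G) (mmapE _ e G) !mulr_sumr -big_split.
apply: eq_bigr => m2 _ /=; rewrite mmapU hM mulrDr /=.
have -> : (F@_m1 * G@_m2)%:A = (F@_m1)%:A * (G@_m2)%:A :> A.
  exact: (rmorphM (in_alg A)).
by congr (_ + _); apply: mulrACA.
Qed.

Lemma eq_mmap (h1 h2 : M -> A) F :
  h1 =1 h2 -> mmap (in_alg A) h1 F = mmap (in_alg A) h2 F.
Proof. by move=> h12; apply: eq_bigr => m _; rewrite h12. Qed.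

Lemma mmapDl (h1 h2 : M -> A) F :
  mmap (in_alg A) (fun m => h1 m + h2 m) F
    = mmap (in_alg A) h1 F + mmap (in_alg A) h2 F.
Proof. by rewrite -big_split; apply: eq_bigr => m _; apply: mulrDr. Qed.

Lemma mmapMl (h : M -> A) (a : A) F :
  mmap (in_alg A) (fun m => a * h m) F = a * mmap (in_alg A) h F.
Proof. by rewrite [RHS]mulr_sumr; apply: eq_bigr => m _; apply: mulrCA. Qed.

End MonoidAlgebra.

Lemma sum_mulDr (R : nzRingType) (T : Type) (r : seq T) (a b c : T -> R) :
  \sum_(i <- r) a i * (b i + c i) =
    \sum_(i <- r) a i * b i + \sum_(i <- r) a i * c i.
Proof. by rewrite -big_split; apply: eq_bigr => i _; apply: mulrDr. Qed.

Lemma sum_mulCA (R : comNzRingType) (T : Type) (r : seq T) (a b : T -> R) (c :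
  R) :
  \sum_(i <- r) a i * (c * b i) = c * \sum_(i <- r) a i * b i.
Proof. by rewrite mulr_sumr; apply: eq_bigr => i _; apply: mulrCA. Qed.

Lemma mmap_id (K : fieldType) (M : conomType) (F : {malg K[M]}) :
  mmap (in_alg {malg K[M]}) (fun m => << m >>) F = F.
Proof.
rewrite [RHS]monalgE mmapE; apply: eq_bigr => m _.
by rewrite [RHS]malgUZ /= mulr_algl.
Qed.

Lemma leibniz_term (R : comNzRingType) (a b1 b2 u1 u2 x : R) n1 n2 :
  a *+ n1 = b1 * u2 *+ n1 -> a *+ n2 = b2 * u1 *+ n2 ->
  a *+ (n1 + n2) * x = b1 *+ n1 * x * u2 + u1 * (b2 *+ n2 * x).
Proof.
move=> e1 e2; rewrite mulrnDr e1 e2 mulrDl -!mulrnAl mulrAC; congr (_ + _).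
by rewrite mulrA [u1 * _]mulrC.
Qed.

Lemma mulrC_addr (R : comNzRingType) (a b c : R) : a * b + c = b * a + c.
Proof. by rewrite mulrC. Qed.

Section Derivations.
Variables (K : fieldType) (I : choiceType).
Implicit Types (F G : sym K I) (D : I -> sym K I).

Definition cmderiv D (m : {cmonom I}) : sym K I :=
  \sum_(v <- finsupp m) (<< divcm m (@ucm I v) >> *+ m v) * D v.

Lemma cmderivEw D (m : {cmonom I}) (d : {fset I}) : (finsupp m `<=` d)%fset ->
  cmderiv D m = \sum_(v <- d) (<< divcm m (@ucm I v) >> *+ m v) * D v.
Proof.
move=> le; rewrite /cmderiv (big_fset_incl _ le) //.
by move=> i i_in_d; rewrite -cmE_neq0 negbK => /eqP->; rewrite mulr0n mul0r.
Qed.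

(** Division of monomials truncates, so it may fail to commute with the product when v does not
    occur in [m1]; there the multiplicity [n] = 0 kills both sides. *)
Lemma divcm_mull (m1 m2 : {cmonom I}) v n : n = m1 v ->
  << divcm (mmul m1 m2) (@ucm I v) >> *+ n
    = << divcm m1 (@ucm I v) >> * << m2 >> *+ n :> sym K I.
Proof.
case: n => [|n] m1v; first by rewrite !mulr0n.
suff -> : divcm (mmul m1 m2) (@ucm I v) = mmul (divcm m1 (@ucm I v)) m2.
  by rewrite malgUM.
apply/eqP/cmP=> i; rewrite divcmE !cmM divcmE cmU.
case: eqP => [<-|_]; last by rewrite !subn0.
by rewrite addnBAC // -m1v.
Qed.

Lemma cmderivM D (m1 m2 : {cmonom I}) :
  cmderiv D (mmul m1 m2) = cmderiv D m1 * << m2 >> + << m1 >> * cmderiv D m2.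
Proof.
rewrite {1}/cmderiv mdomD.
rewrite (cmderivEw D (fsubsetUl _ (finsupp m2))).
rewrite (cmderivEw D (fsubsetUr (finsupp m1) _)).
rewrite mulr_suml mulr_sumr -big_split /=; apply: eq_bigr => v _.
rewrite [mmul m1 m2 v]cmM; apply: leibniz_term; first exact: divcm_mull.
by rewrite mulmC; apply: divcm_mull.
Qed.

Lemma sderivE D F : sderiv D F = mmap (in_alg (sym K I)) (cmderiv D) F.
Proof. by []. Qed.

Lemma sderiv_additive D : additive (sderiv D).
Proof. by move=> F G; rewrite !sderivE raddfB. Qed.
HB.instance Definition _ D :=
  GRing.isZmodMorphism.Build (sym K I) (sym K I) (sderiv D) (sderiv_additive D).

Lemma sderivU D (m : {cmonom I}) : sderiv D << m >> = cmderiv D m.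
Proof. by rewrite sderivE mmapU /= scale1r mul1r. Qed.

Lemma sderiv_scalable D : scalable (sderiv D).
Proof. exact: mmap_scalable. Qed.
HB.instance Definition _ D :=
  GRing.isScalable.Build K (sym K I) (sym K I) *:%R (sderiv D)
    (sderiv_scalable D).

Lemma sderivM D F G : sderiv D (F * G) = sderiv D F * G + F * sderiv D G.
Proof.
by rewrite !sderivE (mmap_derivation _ _ (cmderivM D)) !mmap_id.
Qed.

Lemma sderiv_svar D v : sderiv D (svar K v) = D v.
Proof.
rewrite sderivU /cmderiv mdomU big_seq_fset1 cmUU mulr1n.
suff -> : divcm (@ucm I v) (@ucm I v) = mone by rewrite mul1r.
by apply/eqP/cmP=> i; rewrite divcmE cm1 subnn.
Qed.

Lemma sderiv_scalar D (c : K) : sderiv D c%:A = 0.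
Proof.
rewrite linearZ /= (_ : sderiv D 1 = 0) ?scaler0 //.
have := sderivM D 1 1; rewrite mulr1 mul1r => /esym/eqP.
by rewrite mulr1 -subr_eq0 addrK => /eqP.
Qed.

(** Serves to identify the formal differential at a point with the first-order coefficient along a
    line, both being derivations over the evaluation there. *)
Lemma deriv_eq (A : comAlgType K) (ev : sym K I -> A)
    (d1 d2 : {linear sym K I -> A}) :
  (forall F G, d1 (F * G) = d1 F * ev G + ev F * d1 G) ->
  (forall F G, d2 (F * G) = d2 F * ev G + ev F * d2 G) ->
  ev 1 = 1 ->
  (forall v, d1 (svar K v) = d2 (svar K v)) -> d1 =1 d2.
Proof.
move=> d1M d2M ev1 d12; elim/sym_ind => [c|//|F G IHF IHG|F G IHF IHG].
- suff d0 (d : {linear sym K I -> A}) : (forall F G, d (F * G) = d F * ev G +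
  ev F * d G) -> d 1 = 0.
    by rewrite !linearZ !d0.
  move=> /(_ 1 1); rewrite mulr1 ev1 mul1r mulr1 => /esym/eqP.
  by rewrite -subr_eq0 addrK => /eqP.
- by rewrite !raddfD /= IHF IHG.
- by rewrite d1M d2M IHF IHG.
Qed.

Lemma sderivDl D1 D2 F : sderiv (fun v => D1 v + D2 v) F = sderiv D1 F + sderiv
  D2 F.
Proof.
rewrite !sderivE -mmapDl; apply: eq_mmap => m; exact: sum_mulDr.
Qed.

Lemma sderivMl D G F : sderiv (fun v => G * D v) F = G * sderiv D F.
Proof.
rewrite !sderivE -mmapMl; apply: eq_mmap => m; exact: sum_mulCA.
Qed.

Lemma eq_sderiv D1 D2 F : D1 =1 D2 -> sderiv D1 F = sderiv D2 F.
Proof.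
move=> D12; rewrite !sderivE; apply: eq_mmap => m.
by apply: eq_bigr => v _; rewrite D12.
Qed.

Section Poisson.
Variable br : I -> I -> sym K I.

Lemma poisson_svarl u G : poisson br (svar K u) G = sderiv (br u) G.
Proof. exact: sderiv_svar. Qed.

Lemma poissonMl F1 F2 G :
  poisson br (F1 * F2) G = poisson br F1 G * F2 + F1 * poisson br F2 G.
Proof. exact: sderivM. Qed.

Lemma poissonDl F1 F2 G : poisson br (F1 + F2) G = poisson br F1 G + poisson br
  F2 G.
Proof. exact: raddfD. Qed.

Lemma poisson_scalarl (c : K) G : poisson br c%:A G = 0.
Proof. exact: sderiv_scalar. Qed.

Lemma poisson_scalarr (c : K) F : poisson br F c%:A = 0.
Proof.
rewrite /poisson (eq_sderiv (D2 := fun v => 0 * 0));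
  first by rewrite (sderivMl (fun=>0)) mul0r.
by move=> v; rewrite sderiv_scalar mul0r.
Qed.

Lemma poissonDr F G1 G2 : poisson br F (G1 + G2) = poisson br F G1 + poisson br
  F G2.
Proof.
by rewrite /poisson -sderivDl; apply: eq_sderiv => v; rewrite raddfD.
Qed.

Lemma poissonMr F G1 G2 :
  poisson br F (G1 * G2) = poisson br F G1 * G2 + G1 * poisson br F G2.
Proof.
rewrite /poisson [X in X + _]mulrC -(sderivMl _ G2) -(sderivMl _ G1) -sderivDl.
apply: eq_sderiv => v; apply: etrans (sderivM _ _ _) _.
exact: mulrC_addr.
Qed.

Hypothesis br_anti : forall u v, br u v = - br v u.

Lemma poisson_anti F G : poisson br F G = - poisson br G F.
Proof.
elim/sym_ind: F => [c|u|F1 F2 IH1 IH2|F1 F2 IH1 IH2].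
- by rewrite poisson_scalarl poisson_scalarr oppr0.
- rewrite poisson_svarl /poisson -mulN1r -sderivMl; apply: eq_sderiv => v.
  by rewrite sderiv_svar mulN1r.
- by rewrite poissonDl poissonDr opprD IH1 IH2.
- by rewrite poissonMl poissonMr opprD IH1 IH2 mulrN mulNr.
Qed.

(** By antisymmetry, the bracket with F is a derivation whose values on the generators are the ones
    assumed to vanish. *)
Lemma poisson_centerP F :
  (forall u, sderiv (br u) F = 0) -> poisson_center br F.
Proof.
move=> F0 G; rewrite poisson_anti; apply/eqP; rewrite oppr_eq0; apply/eqP.
rewrite /poisson (eq_sderiv (D2 := fun v => 0 * 0));
  first by rewrite (sderivMl (fun=>0)) mul0r.
by move=> v; rewrite F0 mul0r.
Qed.

End Poisson.
End Derivations.

(** * Coefficient arrays and divided differences *)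

Section Arrays.
Variable K : fieldType.
Implicit Types (S R : nat -> nat -> K) (u v : {poly K}).

(* With S standing for the polynomial sum_(a, b) S a b x^a y^b, these are     *)
(* multiplication and (for alternating R) division by x - y.                  *)
Definition xy_mul S a b : K :=
  (if a is a'.+1 then S a' b else 0) - (if b is b'.+1 then S a b' else 0).

Definition xy_div R a b : K := - \sum_(i < a.+1) R i (a + b.+1 - i)%N.

Lemma xy_mulK S a b : xy_div (xy_mul S) a b = S a b.
Proof.
rewrite /xy_div; elim: a b => [|a IHa] b.
  by rewrite big_ord1 /xy_mul add0n subn0 sub0r opprK.
rewrite big_ord_recr /= opprD addSnnS IHa -addSnnS addKn.
by rewrite /xy_mul /= opprB addrC subrK.
Qed.

Lemma eq_xy_div R1 R2 : R1 =2 R2 -> xy_div R1 =2 xy_div R2.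
Proof. by move=> R12 a b; rewrite /xy_div; under eq_bigr do rewrite R12. Qed.

Definition wedge u v a b : K := u`_a * v`_b - u`_b * v`_a.

Lemma wedge_anti u v a b : wedge u v a b = - wedge u v b a.
Proof. by rewrite /wedge opprB. Qed.

Section Division.
Hypothesis two_neq0 : 2%:R != 0 :> K.
Variables (R : nat -> nat -> K) (n : nat).
Hypothesis R_anti : forall a b, R a b = - R b a.
Hypothesis R_supp : forall a b, (n < b)%N -> R a b = 0.

(** This is the coefficient of x^s in R(x, x), the obstruction to divisibility by x - y; reversing
    the antidiagonal changes its sign. *)
Lemma sum_antidiagonal s : \sum_(i < s.+1) R i (s - i)%N = 0.
Proof.
set T := \sum_(i < _) _;
  suff: T *+ 2 == 0 by rewrite -mulr_natr mulf_eq0 (negPf two_neq0) orbF =>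
    /eqP.
rewrite mulr2n {1}/T (reindex_inj rev_ord_inj) /= -big_split /= big1 // => i _.
by rewrite subSS subKn ?leq_ord // R_anti addNr.
Qed.

(** The full antidiagonal sums to zero; cutting it after index a expresses one part through the
    other. *)
Lemma xy_div_sym a b : xy_div R a b = xy_div R b a.
Proof.
rewrite /xy_div (_ : b + a.+1 = a + b.+1)%N; last by rewrite addnC addSnnS.
set s := (a + b.+1)%N.
have := sum_antidiagonal s; rewrite /s -addSn big_split_ord /= -/s.
move/eqP; rewrite addr_eq0 => /eqP->; congr (- _);
  rewrite -sumrN (reindex_inj rev_ord_inj) /=.
apply: eq_bigr => i _; rewrite R_anti opprK.
have le_i := leq_ord i; rewrite subSS.
have -> : (a.+1 + (b - i) = s - i)%N by rewrite /s; lia.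
by rewrite subKn // /s; lia.
Qed.

Lemma xy_div_supp a b : (n <= a)%N || (n <= b)%N -> xy_div R a b = 0.
Proof.
wlog le_b : a b / (n <= b)%N.
  by move=> IH /orP[]le; first rewrite xy_div_sym; apply: IH; rewrite ?le ?orbT.
move=> _; rewrite /xy_div big1 ?oppr0 // => i _; apply: R_supp.
by have := leq_ord i; lia.
Qed.

Lemma xy_divK a b : xy_mul (xy_div R) a b = R a b.
Proof.
have div0 b' : xy_div R 0 b' = - R 0%N b'.+1 by rewrite /xy_div big_ord1 subn0.
rewrite /xy_mul; case: a b => [|a] [|b].
- have := R_anti 0 0 => /eqP; rewrite -addr_eq0 -mulr2n -mulr_natr mulf_eq0.
  by rewrite (negPf two_neq0) orbF => /eqP->; rewrite subrr.
- by rewrite div0 sub0r opprK.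
- by rewrite xy_div_sym div0 -R_anti subr0.
rewrite /xy_div opprK [X in _ + X]big_ord_recr /= addSnnS addrA addNr add0r;
  congr R; lia.
Qed.

End Division.

(** Summation by parts, with boundary terms removed by the support of S. The family [g] is arbitrary
    so as to cover values at points, bilinear expressions and polynomials. *)
Lemma xy_mul_sum (V : lmodType K) S n (g : nat -> nat -> V) :
  (forall a b, (n <= a)%N || (n <= b)%N -> S a b = 0) ->
  \sum_(a < n) \sum_(b < n) S a b *: (g a.+1 b - g a b.+1)
    = \sum_(a < n.+1) \sum_(b < n.+1) xy_mul S a b *: g a b.
Proof.
move=> S0; rewrite /xy_mul.
under [RHS]eq_bigr => a _.
  under eq_bigr do rewrite scalerBl.
  rewrite sumrB.
  over.
under [LHS]eq_bigr => a _.
  under eq_bigr do rewrite scalerBr.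
  rewrite sumrB.
  over.
rewrite !sumrB; congr (_ - _).
  rewrite [RHS]big_ord_recl [X in _ = X + _]big1 ?add0r => [|b _];
    last by rewrite scale0r.
  apply: eq_bigr => a _; rewrite [RHS]big_ord_recr /= S0 ?leqnn ?orbT //.
  by rewrite scale0r addr0.
rewrite [RHS]big_ord_recr /= [X in _ = _ + X]big1 ?addr0 => [|[[|b] lt_b] _] /=.
- apply: eq_bigr => a _; rewrite [RHS]big_ord_recl /= scale0r add0r.
  by apply: eq_bigr => b _.
- by rewrite scale0r.
- by rewrite S0 ?leqnn // scale0r.
Qed.

Lemma xy_mul_horner S n x y :
  (forall a b, (n <= a)%N || (n <= b)%N -> S a b = 0) ->
  (x - y) * (\sum_(a < n) \sum_(b < n) S a b * (x ^+ a * y ^+ b))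
    = \sum_(a < n.+1) \sum_(b < n.+1) xy_mul S a b * (x ^+ a * y ^+ b).
Proof.
move=> S0; have /= <- := xy_mul_sum (V := K^o) (fun a b => x ^+ a * y ^+ b) S0.
rewrite mulr_sumr; apply: eq_bigr => a _; rewrite mulr_sumr.
apply: eq_bigr => b _; rewrite /GRing.scale /= mulrCA; congr (_ * _).
by rewrite mulrBl !exprS !mulrA [y * _]mulrC.
Qed.

Lemma wedge_horner u v n x y : (size u <= n)%N -> (size v <= n)%N ->
  \sum_(a < n) \sum_(b < n) wedge u v a b * (x ^+ a * y ^+ b)
    = u.[x] * v.[y] - u.[y] * v.[x].
Proof.
move=> su sv; rewrite [u.[y] * _]mulrC !(horner_coef_wide _ su)
  !(horner_coef_wide _ sv).
rewrite !mulr_suml -sumrB; apply: eq_bigr => a _; rewrite !mulr_sumr -sumrB.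
apply: eq_bigr => b _; rewrite /wedge mulrBl mulrACA; congr (_ - _).
by rewrite [u`_b * _]mulrC mulrACA.
Qed.

End Arrays.

(** * Bilinear expressions in the currents *)

Section Bilinear.
Variables (K : fieldType) (A : comAlgType K) (d : nat).
Variable e : 'I_d -> {linear {poly K} -> A}.
Implicit Types (M : 'I_d -> 'I_d -> K) (r s u v : {poly K}).

Definition bil M r s : A := \sum_j \sum_k M j k *: (e j r * e k s).

Lemma bil_sum M (I J : finType) (u : I -> K) (r : I -> {poly K}) (v : J -> K)
    (s : J -> {poly K}) :
  bil M (\sum_a u a *: r a) (\sum_b v b *: s b)
    = \sum_a \sum_b (u a * v b) *: bil M (r a) (s b).
Proof.
rewrite /bil.
under [RHS]eq_bigr => a _ do under eq_bigr => b _ do rewrite scaler_sumr.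
under [RHS]eq_bigr => a _ do rewrite exchange_big.
rewrite [RHS]exchange_big; apply: eq_bigr => j _.
under [RHS]eq_bigr => a _ do under eq_bigr => b _ do rewrite scaler_sumr.
under [RHS]eq_bigr => a _ do rewrite exchange_big.
rewrite [RHS]exchange_big; apply: eq_bigr => k _.
rewrite !linear_sum mulr_suml scaler_sumr; apply: eq_bigr => a _.
rewrite mulr_sumr scaler_sumr; apply: eq_bigr => b _.
by rewrite !linearZ -scalerAl -scalerAr /= !scalerA mulrA.
Qed.

Lemma bil_anti M r s : (forall j k, M j k = - M k j) -> bil M r s = - bil M s r.
Proof.
move=> M_anti; rewrite /bil exchange_big -sumrN; apply: eq_bigr => k _.
rewrite -sumrN; apply: eq_bigr => j _.
by rewrite M_anti scaleNr mulrC.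
Qed.

Lemma wedge_bil M u v n r s : (size u <= n)%N -> (size v <= n)%N ->
  \sum_(a < n) \sum_(b < n) wedge u v a b *: bil M (r * 'X^a) (s * 'X^b)
    = bil M (r * u) (s * v) - bil M (r * v) (s * u).
Proof.
move=> su sv.
have exp (w t : {poly K}) : (size w <= n)%N -> t * w = \sum_(a < n) w`_a *: (t
  * 'X^a).
  move=> sw; rewrite -[in LHS](coefK w) (@poly_def _ (size w)).
  rewrite mulr_sumr (big_ord_widen _ (fun a => t * (w`_a *: 'X^a)) sw).
  rewrite big_mkcond; apply: eq_bigr => a _; rewrite -scalerAr;
    case: ltnP => // le.
  by rewrite nth_default // scale0r.
rewrite !(exp u _ su) !(exp v _ sv) !bil_sum -sumrB.
apply: eq_bigr => a _; rewrite -sumrB; apply: eq_bigr => b _.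
by rewrite -scalerBl /wedge [u`_b * _]mulrC.
Qed.

Variables (p : {poly K}) (n : nat).
Hypothesis size_p : size p = n.+1.
Hypothesis e_dvdp : forall j r, p %| r -> e j r = 0.

Lemma bil_dvdl M r s : p %| r -> bil M r s = 0.
Proof.
by move=> pr; rewrite /bil big1 // => j _; rewrite big1 // => k _;
  rewrite e_dvdp // mul0r scaler0.
Qed.

Lemma bil_dvdr M r s : p %| s -> bil M r s = 0.
Proof.
by move=> pr; rewrite /bil big1 // => j _; rewrite big1 // => k _;
  rewrite [e k s]e_dvdp // mulr0 scaler0.
Qed.

Section Central.
Variables (S : nat -> nat -> K) (g : {poly K}) (M : 'I_d -> 'I_d -> K).
Hypothesis size_g : (size g <= n.+1)%N.
Hypothesis S_supp : forall a b, (n <= a)%N || (n <= b)%N -> S a b = 0.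
Hypothesis S_mul : forall a b, xy_mul S a b = wedge p g a b.

(** Moving one factor t from one argument to the other changes the sum by (x - y) S = p(x)g(y) -
    p(y)g(x), each term of which has an argument divisible by p. *)
Lemma bil_shift m l :
  \sum_(a < n) \sum_(b < n) S a b *: bil M ('X^l * 'X^a) ('X^m * 'X^b)
    = \sum_(a < n) \sum_(b < n) S a b *: bil M ('X^(l + m) * 'X^a) 'X^b.
Proof.
elim: m l => [|m IHm] l.
  by rewrite addn0; under eq_bigr do under eq_bigr do rewrite mul1r.
rewrite addnS -addSn -IHm; apply/eqP; rewrite eq_sym -subr_eq0 -sumrB.
under eq_bigr do rewrite -sumrB.
under eq_bigr do under eq_bigr do rewrite -scalerBr !exprSr -!mulrA -!exprS.
rewrite (xy_mul_sum (fun a b => bil M ('X^l * 'X^a) ('X^m * 'X^b)) S_supp).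
under eq_bigr do under eq_bigr do rewrite S_mul.
by rewrite wedge_bil ?size_p // bil_dvdl ?bil_dvdr ?subrr ?dvdp_mulIr.
Qed.

Lemma bil_central m :
  \sum_(a < n) \sum_(b < n)
     S a b *: (bil M 'X^a ('X^m * 'X^b) - bil M ('X^m * 'X^a) 'X^b) = 0.
Proof.
under eq_bigr do under eq_bigr do rewrite scalerBr.
under eq_bigr do rewrite sumrB.
rewrite sumrB; have := bil_shift m 0; rewrite add0n => <-.
by under [X in _ - X]eq_bigr do under eq_bigr do rewrite mul1r; rewrite subrr.
Qed.

End Central.

(** * Lagrange interpolation at the distinct roots of p *)

Section Lagrange.
Variables (a : 'I_n -> K).
Hypothesis a_inj : injective a.
Hypothesis def_p : p = \prod_i ('X - (a i)%:P).

Lemma lagrange_div i : p %/ ('X - (a i)%:P) = \prod_(j | j != i) ('X - (a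
  j)%:P).
Proof. by rewrite def_p (bigD1 i) //= mulKp ?polyXsubC_eq0. Qed.

Lemma lagrange_horner i k : (lagrange_basis p a i).[a k] = (k == i)%:R.
Proof.
rewrite /lagrange_basis lagrange_div hornerZ horner_prod.
under [X in _ * X]eq_bigr do rewrite hornerXsubC.
have [->|ki] := eqVneq k i.
  rewrite mulVf //; apply/prodf_neq0 => j ji.
  by rewrite subr_eq0 (inj_eq a_inj) eq_sym.
by rewrite [X in _ * X](bigD1 k) //= subrr mul0r mulr0.
Qed.

Lemma size_lagrange_basis i : (size (lagrange_basis p a i) <= n)%N.
Proof.
apply: leq_trans (size_scale_leq _ _) _.
by rewrite size_divp ?polyXsubC_eq0 // size_XsubC size_p subn1.
Qed.

Lemma lagrange_dvd r : (forall i, r.[a i] = 0) -> p %| r.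
Proof.
move=> ra; rewrite def_p -(big_map a xpredT (fun z => 'X - z%:P)) -[index_enum
  _]enumT.
apply: uniq_roots_dvdp; last by rewrite uniq_rootsE map_inj_uniq ?enum_uniq.
by apply/allP => _ /mapP[i _ ->]; apply/rootP.
Qed.

Lemma lagrange_expand j r :
  e j r = e j (\sum_i r.[a i] *: lagrange_basis p a i).
Proof.
apply/eqP; rewrite -subr_eq0 -linearB e_dvdp //; apply: lagrange_dvd => k.
rewrite hornerD hornerN horner_sum (bigD1 k) //= hornerZ lagrange_horner eqxx
  mulr1.
rewrite big1 ?addr0 ?subrr // => i ik.
by rewrite hornerZ lagrange_horner eq_sym (negPf ik) mulr0.
Qed.

Lemma bil_lagrange M r s :
  bil M r s = \sum_i \sum_k (r.[a i] * s.[a k])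
     *: bil M (lagrange_basis p a i) (lagrange_basis p a k).
Proof.
rewrite -bil_sum; apply: eq_bigr => j _; apply: eq_bigr => k _.
by congr (_ *: (_ * _)); apply: lagrange_expand.
Qed.

(** Passing to the Lagrange basis turns an array of coefficients into the table of values of its
    polynomial at pairs of roots. *)
Lemma sum_bil_lagrange M l (S : nat -> nat -> K) :
  \sum_(b < l) \sum_(c < l) S b c *: bil M 'X^b 'X^c
    = \sum_i \sum_k (\sum_(b < l) \sum_(c < l) S b c * (a i ^+ b * a k ^+ c))
     *: bil M (lagrange_basis p a i) (lagrange_basis p a k).
Proof.
under eq_bigr => b _ do under eq_bigr => c _ do rewrite bil_lagrange
  scaler_sumr.
under eq_bigr => b _ do rewrite exchange_big.
rewrite [LHS]exchange_big; apply: eq_bigr => i _.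
under eq_bigr => b _ do under eq_bigr => c _ do rewrite scaler_sumr.
under eq_bigr => b _ do rewrite exchange_big.
rewrite [LHS]exchange_big; apply: eq_bigr => k _.
rewrite scaler_suml; apply: eq_bigr => b _; rewrite scaler_suml.
by apply: eq_bigr => c _; rewrite scalerA !hornerXn.
Qed.

(** Modulo p, r_i is an eigenvector of multiplication by t, since it vanishes at all roots other
    than a_i. *)
Lemma lagrange_shift j m i :
  e j ('X^m * lagrange_basis p a i) = a i ^+ m *: e j (lagrange_basis p a i).
Proof.
rewrite lagrange_expand (bigD1 i) //= big1 ?addr0 => [|k ik].
  by rewrite hornerM hornerXn lagrange_horner eqxx mulr1 linearZ.
by rewrite hornerM lagrange_horner (negPf ik) mulr0 scale0r.
Qed.

Lemma bil_lagrange_shift M m i :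
  bil M (lagrange_basis p a i) ('X^m * lagrange_basis p a i)
    = bil M ('X^m * lagrange_basis p a i) (lagrange_basis p a i).
Proof.
apply: eq_bigr => j _; apply: eq_bigr => k _; congr (_ *: _).
by rewrite !lagrange_shift -scalerAl -scalerAr.
Qed.

(** Off the diagonal, s lives on a star centred at m, the shape of a Gaudin Hamiltonian; as h is
    symmetric, opposite entries add up. *)
Lemma sum_star (h : 'I_n -> 'I_n -> A) (s : 'I_n -> 'I_n -> K) (t : 'I_n -> K)
  m :
  (forall i k, h i k = h k i) -> (forall i k, i != k -> i != m -> k != m -> s i
    k = 0) ->
  (forall k, k != m -> s m k + s k m = t k) ->
  \sum_i \sum_k s i k *: h i k
    = \sum_i s i i *: h i i + \sum_(k | k != m) t k *: h m k.
Proof.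
move=> h_sym s0 st.
have E i : i != m -> \sum_k s i k *: h i k = s i i *: h i i + s i m *: h m i.
  move=> im; rewrite (bigD1 i) //= (bigD1 m) /=; last by rewrite eq_sym.
  rewrite h_sym big1 ?addr0 // => k /andP[ki km].
  by rewrite s0 ?scale0r // eq_sym.
rewrite (bigD1 m) //= [in RHS](bigD1 m) //= (bigD1 m) //= -!addrA;
  congr (_ + _).
rewrite (eq_bigr _ E) big_split /= addrCA; congr (_ + _); rewrite -big_split.
by apply: eq_bigr => k km /=; rewrite -scalerDl st.
Qed.

End Lagrange.

End Bilinear.

(** * Invariance of the form under the Lie algebra *)

Lemma seval_comp (K : fieldType) (I : choiceType) (A A' : comAlgType K)
    (phi : {lrmorphism A -> A'}) (f : I -> A) F :
  phi (seval f F) = seval (phi \o f) F.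
Proof. by apply: (seval_uniq (phi := phi \o seval f)) => v /=;
  rewrite seval_svar. Qed.

Lemma eq_seval (K : fieldType) (I : choiceType) (A : comAlgType K)
    (f1 f2 : I -> A) F : f1 =1 f2 -> seval f1 F = seval f2 F.
Proof.
by move=> f12; apply: (seval_uniq (phi := seval f1)) => v; rewrite -f12;
  apply: seval_svar.
Qed.

Section ConjugationPolynomial.
Variables (K : fieldType) (N : nat) (b : 'M[K]_N -> 'M[K]_N -> K) (Y Z :
  'M[K]_N) (c : K).

Definition conj_adj (A : comAlgType K) (G : 'M[A]_N) (U : 'M[K]_N) : 'M[A]_N :=
  G *m map_mx (in_alg A) U *m \adj G.

Definition mx_bil (A : comAlgType K) (U V : 'M[A]_N) : A :=
  \sum_i \sum_j \sum_k \sum_l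
    b (delta_mx i j) (delta_mx k l) *: (U i j * V k l).

(* The adjugate and (det G)^2 make B (Ad_g Y) (Ad_g Z) - B Y Z polynomial in  *)
(* the entries of g.                                                          *)
Definition conj_poly (A : comAlgType K) (G : 'M[A]_N) : A :=
  mx_bil (conj_adj G Y) (conj_adj G Z) - c *: (\det G) ^+ 2.

(** Naturality in the algebra lets one polynomial in the matrix entries be specialised both at
    points of the group and along a line. *)
Lemma conj_poly_morph (A A' : comAlgType K) (phi : {lrmorphism A -> A'}) G :
  phi (conj_poly G) = conj_poly (map_mx phi G).
Proof.
have conjE U : conj_adj (map_mx phi G) U = map_mx phi (conj_adj G U).
  rewrite !map_mxM map_mx_adj -map_mx_comp; congr (_ *m _ *m _).
  by apply/matrixP => i j; rewrite !mxE /= linearZ rmorph1.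
rewrite /conj_poly raddfB /= det_map_mx !conjE; congr (_ - _); last first.
  by rewrite linearZ; congr (_ *: _); apply: rmorphXn.
rewrite linear_sum; apply: eq_bigr => i _; rewrite linear_sum;
  apply: eq_bigr => j _.
rewrite linear_sum; apply: eq_bigr => k _; rewrite linear_sum;
  apply: eq_bigr => l _.
by rewrite linearZ rmorphM !mxE.
Qed.

End ConjugationPolynomial.

(** * First-order expansions of matrices over K[t] *)

Section PolyMatrix.
Variables (K : fieldType) (N : nat).

Lemma coefM1 (f g : {poly K}) : (f * g)`_1 = f`_0 * g`_1 + f`_1 * g`_0.
Proof. by rewrite coefM big_ord_recl big_ord1. Qed.

Lemma map_coef0M m n l (U : 'M[{poly K}]_(m, n)) (V : 'M[{poly K}]_(n, l)) :
  map_mx (coefp 0) (U *m V) = map_mx (coefp 0) U *m map_mx (coefp 0) V.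
Proof.
apply/matrixP=> i j; rewrite !mxE raddf_sum; apply: eq_bigr => k _.
by rewrite !mxE /= coef0M.
Qed.

Lemma map_coef1M m n l (U : 'M[{poly K}]_(m, n)) (V : 'M[{poly K}]_(n, l)) :
  map_mx (coefp 1) (U *m V)
    = map_mx (coefp 0) U *m map_mx (coefp 1) V
      + map_mx (coefp 1) U *m map_mx (coefp 0) V.
Proof.
apply/matrixP=> i j; rewrite !mxE raddf_sum -big_split; apply: eq_bigr => k _.
by rewrite !mxE /= coefM1.
Qed.

Definition curve (X : 'M[K]_N) : 'M[{poly K}]_N :=
  \matrix_(i, j) (((1%:M : 'M[K]_N) i j)%:P + X i j *: 'X).

Lemma curve_coef0 X : map_mx (coefp 0) (curve X) = 1%:M.
Proof.
by apply/matrixP=> i j; rewrite !mxE /= coefD coefC coefZ coefX mulr0 addr0.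
Qed.

Lemma curve_coef1 X : map_mx (coefp 1) (curve X) = X.
Proof.
by apply/matrixP=> i j; rewrite !mxE /= coefD coefC coefZ coefX mulr1 add0r.
Qed.

Lemma det_curve0 X : (\det (curve X))`_0 = 1.
Proof. by rewrite -[LHS]/(coefp 0 _) -det_map_mx curve_coef0 det1. Qed.

Lemma adj_curve0 X : map_mx (coefp 0) (\adj (curve X)) = 1%:M.
Proof. by rewrite map_mx_adj curve_coef0 adj1. Qed.

(** This is the first-order part of adj(G) G = det(G) 1 for G = 1 + tX. *)
Lemma adj_curve1 X :
  map_mx (coefp 1) (\adj (curve X)) = ((\det (curve X))`_1)%:M - X.
Proof.
have := congr1 (map_mx (coefp 1)) (mul_adj_mx (curve X)).
rewrite map_coef1M curve_coef0 curve_coef1 adj_curve0 mul1mx mulmx1.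
move=> /(canRL (addKr _)) ->; rewrite addrC; congr (_ - _).
by apply/matrixP=> i j; rewrite !mxE /= coefMn.
Qed.

Lemma conj_curve0 X U : map_mx (coefp 0) (conj_adj (curve X) U) = U.
Proof.
rewrite !map_coef0M curve_coef0 adj_curve0 mul1mx mulmx1.
by apply/matrixP=> i j; rewrite !mxE /= coefZ coef1 mulr1.
Qed.

Lemma conj_curve1 X U :
  map_mx (coefp 1) (conj_adj (curve X) U)
    = (X *m U - U *m X) + (\det (curve X))`_1 *: U.
Proof.
have U0 : map_mx (coefp 0) (map_mx (in_alg {poly K}) U) = U.
  by apply/matrixP=> i j; rewrite !mxE /= coefZ coef1 mulr1.
have U1 : map_mx (coefp 1) (map_mx (in_alg {poly K}) U) = 0.
  by apply/matrixP=> i j; rewrite !mxE /= coefZ coef1 mulr0.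
rewrite !map_coef1M !map_coef0M curve_coef0 curve_coef1 U0 U1 adj_curve0
  adj_curve1.
rewrite !mulmx1 !mul1mx add0r mulmxBr mul_mx_scalar addrC addrA.
by rewrite addrAC.
Qed.

End PolyMatrix.

(** * Differentials at the identity and the adjoint action *)

Section TangentSpace.
Variables (K : fieldType) (N : nat).
Implicit Types (f : sym K ('I_N * 'I_N)%type) (g X : 'M[K]_N).

Lemma mx_diff1E f X :
  mx_diff1 f X = (seval (fun v => curve X v.1 v.2) f)`_1.
Proof.
pose ev : {lrmorphism sym K ('I_N * 'I_N)%type -> K^o} :=
  seval (fun v => (1%:M : 'M[K]_N) v.1 v.2 : K^o).
pose cv : {lrmorphism sym K ('I_N * 'I_N)%type -> {poly K}} :=
  seval (fun v => curve X v.1 v.2).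
have cv0 F : (cv F)`_0 = ev F.
  elim/sym_ind: F => [c|v|F G IHF IHG|F G IHF IHG].
  - by rewrite linearZ [in RHS]linearZ !rmorph1 coefZ coef1.
  - by rewrite /cv /ev /= !seval_svar mxE coefD coefC coefZ coefX mulr0 addr0.
  - by rewrite !raddfD coefD IHF IHG.
  - by rewrite !rmorphM coef0M IHF IHG.
pose d1 : {linear sym K ('I_N * 'I_N)%type -> K^o} :=
  ev \o sderiv (fun v => (X v.1 v.2)%:A).
pose d2 : {linear sym K ('I_N * 'I_N)%type -> K^o} := coefp 1 \o cv.
apply: (deriv_eq (ev := ev) (d1 := d1) (d2 := d2)).
- move=> F G; apply: etrans (congr1 ev (sderivM _ F G)) _.
  by apply: etrans (rmorphD ev _ _) _; congr (_ + _); apply: rmorphM.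
- by move=> F G; rewrite /d2 /= rmorphM coefM1 !cv0 addrC.
- exact: rmorph1.
move=> v; rewrite /d1 /d2 /cv /= sderiv_svar linearZ rmorph1 seval_svar mxE.
by rewrite coefD coefC coefZ coefX add0r.
Qed.

(** If f vanishes on Q, so does h -> f(g h g^-1), and its differential along X is that of f along g
    X g^-1. *)
Lemma Lie_conj (Q : 'M[K]_N -> Prop) g X : algebraic_group Q ->
  Q g -> Lie Q X -> Lie Q (g *m X *m invmx g).
Proof.
move=> [[E QE] _ QM QV] Qg LX f f0.
have gU : g \in unitmx by have [] := (QE g).1 Qg.
(* The entries of g G g^-1 as linear combinations of those of G, over any algebra: K and K[t] are
   both used below. *)
pose s (A : comAlgType K) (G : 'M[A]_N) (v : 'I_N * 'I_N) : A :=
  \sum_i \sum_j (g v.1 i * invmx g j v.2) *: G i j.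
pose f' := seval (s _ (\matrix_(i, j) svar K (i, j))) f.
have f'E (A : comAlgType K) (G : 'M[A]_N) : seval (fun v => G v.1 v.2) f' =
  seval (s A G) f.
  pose phi : {lrmorphism sym K ('I_N * 'I_N)%type -> A} := seval (fun v => G
    v.1 v.2).
  apply: etrans (seval_comp phi (s _ _) f) _; apply: eq_seval => v /=.
  rewrite /s /= linear_sum; apply: eq_bigr => i _.
  rewrite linear_sum; apply: eq_bigr => j _.
  by rewrite linearZ; congr (_ *: _); rewrite mxE; apply: seval_svar.
have sE (G : 'M[K]_N) v : s K^o G v = (g *m G *m invmx g) v.1 v.2.
  rewrite /s mxE exchange_big; apply: eq_bigr => j _; rewrite mxE mulr_suml.
  by apply: eq_bigr => i _; rewrite /GRing.scale /= mulrAC.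
have : mx_diff1 f' X = 0.
  apply: LX => h Qh; rewrite /mx_eval f'E.
  rewrite -[RHS](f0 (g *m h *m invmx g)); last by apply: (QM);
    [apply: QM|apply: QV].
  exact: (eq_seval (A := K^o) f (sE h)).
rewrite !mx_diff1E f'E => e0; rewrite -[RHS]e0.
suff e : (fun v => curve (g *m X *m invmx g) v.1 v.2) =1 s _ (curve X).
  by rewrite (eq_seval f e).
move=> v; rewrite mxE /=.
apply/esym; transitivity (\sum_i \sum_j ((g v.1 i * invmx g j v.2) * (1%:M :
  'M[K]_N) i j)%:P
  + \sum_i \sum_j ((g v.1 i * invmx g j v.2) * X i j) *: 'X).
  rewrite -big_split; apply: eq_bigr => i _; rewrite -big_split;
    apply: eq_bigr => j _.
  by rewrite /= [curve X i j]mxE scalerDr scalerA -mul_polyC !polyCM.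
have := sE 1%:M v; rewrite mulmx1 mulmxV // => <-.
rewrite -sE /s raddf_sum scaler_suml; congr (_ + _); apply: eq_bigr => i _.
  by rewrite raddf_sum.
by rewrite scaler_suml.
Qed.

End TangentSpace.

Section Invariance.
Variables (K : fieldType) (N : nat) (Q : 'M[K]_N -> Prop).
Variables (q : lieAlgType K) (iota : {linear q -> 'M[K]_N}) (B : {symmetric q}).
Hypotheses (algQ : algebraic_group Q) (LieQ : Lie_iso Q iota).
Hypothesis BinvQ : Ad_invariant Q iota B.

(** A linear left inverse of [iota] defined on all matrices, through which the form becomes a
    polynomial function of matrix entries. *)
Let P : 'Hom('M[K]_N, q) := ((linfun iota)^-1)%VF.

Lemma Lie_isoK y : P (iota y) = y.
Proof.
have [iota_inj _ _] := LieQ.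
rewrite -[iota y](lfunE iota); apply: lker0_lfunK.
by apply/lker0P => u v; rewrite !lfunE; apply: iota_inj.
Qed.

Let b (U V : 'M[K]_N) : K := B (P U) (P V).

Lemma mx_bilE U V : mx_bil b (A := K^o) U V = b U V.
Proof.
have PE W : P W = \sum_i \sum_j W i j *: P (delta_mx i j).
  rewrite {1}(matrix_sum_delta W) linear_sum; apply: eq_bigr => i _.
  by rewrite linear_sum; apply: eq_bigr => j _; rewrite linearZ.
rewrite {2}/b (PE U) (PE V) linear_sumlz; apply: eq_bigr => i _.
rewrite linear_sumlz; apply: eq_bigr => j _.
rewrite linear_sumr; apply: eq_bigr => k _.
rewrite linear_sumr; apply: eq_bigr => l _.
by rewrite linearZl_LR linearZr_LR /= /GRing.scale /= mulrC -mulrA.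
Qed.

Lemma mx_bil_coef1 (U V : 'M[{poly K}]_N) :
  (mx_bil b U V)`_1 = b (map_mx (coefp 0) U) (map_mx (coefp 1) V)
                      + b (map_mx (coefp 1) U) (map_mx (coefp 0) V).
Proof.
rewrite -!mx_bilE /mx_bil coef_sum -big_split; apply: eq_bigr => i _.
rewrite coef_sum -big_split; apply: eq_bigr => j _.
rewrite coef_sum -big_split; apply: eq_bigr => k _.
rewrite coef_sum -big_split; apply: eq_bigr => l _ /=.
by rewrite coefZ coefM1 !mxE mulrDr.
Qed.

(** On Q, [conj_adj] is det(g) times Ad(g), and Ad(g) preserves Lie Q, where invariance applies; the
    two arguments produce the factor det(g)^2. *)
Lemma conj_poly_vanish y z (g : 'M[K]_N) : Q g ->
  conj_poly b (iota y) (iota z) (B y z) (A := K^o) g = 0.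
Proof.
have [[E QE] _ _ _] := algQ; have [_ LieE _] := LieQ.
move=> Qg; have gU : g \in unitmx by have [] := (QE g).1 Qg.
have Ad u : exists u', iota u' = g *m iota u *m invmx g.
  by apply/LieE; apply: Lie_conj => //; apply/LieE; exists u.
have conjE u u' : iota u' = g *m iota u *m invmx g ->
    conj_adj (g : 'M[K^o]_N) (iota u) = \det g *: iota u'.
  have -> : conj_adj (g : 'M[K^o]_N) (iota u) = g *m iota u *m \adj g.
    congr (_ *m _ *m _); apply/matrixP => i j.
    by rewrite mxE /= /GRing.scale /= mulr1.
  move=> ->; rewrite /invmx gU -scalemxAr scalerA mulfV ?scale1r //.
  by rewrite -unitfE -unitmxE.
have [y' ey] := Ad y; have [z' ez] := Ad z.
rewrite /conj_poly mx_bilE /b (conjE _ _ ey) (conjE _ _ ez) !linearZ /=.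
rewrite linearZl_LR /= !Lie_isoK (BinvQ Qg ey ez) mulrA -expr2.
by rewrite /GRing.scale /= !mulrN -expr2 mulrC subrr.
Qed.

(** Differentiates [conj_poly], which vanishes on Q, at 1 along w. The derivative of the determinant
    adds the same multiple of B y z to both of its terms and cancels. *)
Lemma lie_invariant w y z : B (lie w y) z + B y (lie w z) = 0.
Proof.
have [_ LieE lieE] := LieQ.
pose Gen : 'M[sym K ('I_N * 'I_N)%type]_N := \matrix_(i, j) svar K (i, j).
pose F := conj_poly b (iota y) (iota z) (B y z) Gen.
have FE (A : comAlgType K) (G : 'M[A]_N) :
    seval (fun v => G v.1 v.2) F = conj_poly b (iota y) (iota z) (B y z) G.
  pose phi : {lrmorphism sym K ('I_N * 'I_N)%type -> A} := seval (fun v => G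
    v.1 v.2).
  apply: etrans (conj_poly_morph _ _ _ _ phi Gen) _; congr conj_poly.
  by apply/matrixP => i j; rewrite !mxE; apply: seval_svar.
have : mx_diff1 F (iota w) = 0.
  apply: ((LieE (iota w)).2 _); first by exists w.
  by move=> g Qg; apply: etrans (FE K^o g) (conj_poly_vanish y z Qg).
rewrite mx_diff1E FE /conj_poly coefB coefZ mx_bil_coef1 !conj_curve0
  !conj_curve1.
rewrite expr2 coefM1 !det_curve0 mul1r mulr1 -!lieE /b !linearD !linearZ /=.
rewrite !Lie_isoK linearDl linearZl_LR /=.
set D := (\det (curve (iota w)))`_1; set e1 := B y (lie w z);
  set e2 := B (lie w y) z => e.
by rewrite -[RHS]e mulrDr ![B y z * D]mulrC addrACA addrK addrC.
Qed.

End Invariance.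

(** * The quotient of the current algebra *)

Section LinearCombinations.
Variables (K : fieldType) (V : lmodType K).

Lemma linear_comb (U : lmodType K) (I : finType) (f : I -> U -> K) (g : I -> V)
  :
  (forall i, scalar (f i)) -> linear (fun u => \sum_i f i u *: g i).
Proof.
move=> f_lin c u v; rewrite scaler_sumr -big_split; apply: eq_bigr => i _ /=.
by rewrite f_lin scalerDl scalerA.
Qed.

Lemma linear_combr (U : lmodType K) (I : finType) (c : I -> K) (g : I -> U ->
  V) :
  (forall i, linear (g i)) -> linear (fun u => \sum_i c i *: g i u).
Proof.
move=> g_lin a u v; rewrite scaler_sumr -big_split; apply: eq_bigr => i _ /=.
by rewrite g_lin scalerDr !scalerA mulrC.
Qed.

Lemma sum_delta (I : finType) (j : I) (g : I -> V) : \sum_i (i == j)%:R *: g i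
  = g j.
Proof.
rewrite (bigD1 j) //= eqxx scale1r big1 ?addr0 // => i /negPf ->.
by rewrite scale0r.
Qed.

Lemma modp_comb (p r : {poly K}) n (L : {linear {poly K} -> V}) m :
  size p = n.+1 -> (forall s, p %| s -> L s = 0) ->
  L ('X^m * r) = \sum_(k < n) (r %% p)`_k *: L 'X^(m + k).
Proof.
move=> size_p Lp; have p0 : p != 0 by rewrite -size_poly_eq0 size_p.
have -> : L ('X^m * r) = L ('X^m * (r %% p)).
  rewrite [in LHS](divp_eq r p) mulrDr raddfD /= Lp ?add0r //.
  by rewrite mulrA dvdp_mull.
rewrite -[X in 'X^m * X]coefK (@poly_def _ (size (r %% p))).
have le : (size (r %% p)%R <= n)%N by rewrite -ltnS -size_p ltn_modp.
rewrite (big_ord_widen _ (fun k => (r %% p)`_k *: 'X^k) le) big_mkcond.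
rewrite mulr_sumr linear_sum; apply: eq_bigr => k _.
case: ltnP => [_|ge]; first by rewrite -scalerAr linearZ exprD.
by rewrite mulr0 linear0 nth_default // scale0r.
Qed.

End LinearCombinations.

Section StructureConstants.
Variables (K : fieldType) (q : lieAlgType K) (B : {symmetric q}).
Variables (d : nat) (x : d.-tuple q).
Hypothesis xbasis : basis_of fullv x.
Hypothesis xortho : forall i j : 'I_d, B x`_i x`_j = (i == j)%:R.
Hypothesis Binv : forall w y z, B (lie w y) z + B y (lie w z) = 0.

(** As x is orthonormal, this is the x_k-coordinate of [x_i, x_j]; by [str_antil] and [str_antir] it
    is antisymmetric in all three indices. *)
Definition str (i j k : 'I_d) : K := B (lie x`_i x`_j) x`_k.

Lemma coord_x (i j : 'I_d) : coord x i x`_j = (i == j)%:R.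
Proof. by rewrite coord_free ?(basis_free xbasis) // eq_sym. Qed.

Lemma coordE i y : coord x i y = B y x`_i.
Proof.
rewrite {2}(coord_basis xbasis (memvf y)) linear_sumlz (bigD1 i) //= big1 =>
  [|j ji].
  by rewrite linearZl_LR /= xortho eqxx /GRing.scale /= mulr1 addr0.
by rewrite linearZl_LR /= xortho (negPf ji) /GRing.scale /= mulr0.
Qed.

Lemma lie_anti (y z : q) : lie y z = - lie z y.
Proof.
have lD (f : q -> q) u v : linear f -> f (u + v) = f u + f v.
  by move=> f_lin; rewrite -[u]scale1r f_lin !scale1r.
have := lie_alt (y + z).
rewrite (lD (lie^~ (y + z)) _ _ (lie_linearl _)) /=.
rewrite !(lD _ _ _ (lie_linearr _)) !lie_alt add0r addr0.
by move=> /eqP; rewrite addr_eq0 => /eqP.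
Qed.

Lemma str_antil i j k : str j i k = - str i j k.
Proof. by rewrite /str lie_anti linearNl. Qed.

Lemma str_antir i j k : str i j k = - str i k j.
Proof.
apply/eqP; rewrite -addr_eq0 -(Binv x`_i x`_j x`_k); apply/eqP; congr (_ + _).
by rewrite [RHS]hermC mul1r.
Qed.

Lemma lieE (i j : 'I_d) : lie x`_i x`_j = \sum_k str i j k *: x`_k.
Proof.
rewrite [LHS](coord_basis xbasis (memvf _)).
by apply: eq_bigr => k _; rewrite coordE.
Qed.

(** Noncommutativity of q enters the dimension count in this form. *)
Lemma str_neq0 : (exists y z : q, lie y z != 0) -> exists i j k, str i j k != 0.
Proof.
case=> y [z yz].
have [/existsP[i /existsP[j /existsP[k ijk]]]|] :=
  boolP [exists i, exists j, exists k, str i j k != 0]; first by exists i, j, k.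
rewrite negb_exists => /forallP str0; case/eqP: yz.
have lsum (f : q -> q) (u : q) : linear f -> f u = \sum_i coord x i u *: f x`_i.
  move=> f_lin; pose g : {linear q -> q} := HB.pack f (GRing.isLinear.Build _ _
    _ _ f f_lin).
  rewrite -[f u]/(g u) {1}(coord_basis xbasis (memvf u)) linear_sum.
  by apply: eq_bigr => i _; rewrite linearZ.
rewrite (lsum _ _ (lie_linearl z)) big1 // => i _.
rewrite (lsum _ _ (lie_linearr x`_i)) big1 ?scaler0 // => j _.
rewrite lieE big1 ?scaler0 // => k _.
have := str0 i; rewrite negb_exists => /forallP/(_ j).
by rewrite negb_exists => /forallP/(_ k); rewrite negbK => /eqP->;
  rewrite scale0r.
Qed.

Section Quotient.
Variables (p : {poly K}) (n : nat).
Hypothesis size_p : size p = n.+1.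

Lemma elt_x (T : choiceType) (j : 'I_d) (k : T) : elt x x`_j k = svar K (j, k).
Proof.
apply: etrans (sum_delta j (fun i => svar K (i, k))).
by apply: eq_bigr => i _; rewrite coord_x.
Qed.

Lemma elt_linear (T : choiceType) (k : T) : linear (fun y => elt x y k).
Proof.
by apply: (linear_comb (fun i => svar K (i, k))) => i c u v; rewrite linearP.
Qed.

Lemma barW_linearr y : linear (barW x n p y).
Proof.
apply: (linear_comb (fun k : 'I_n => elt x y k)) => k c r s.
by rewrite modpD modpZl coefD coefZ.
Qed.
HB.instance Definition _ y := GRing.isLinear.Build K {poly K}
  (sym K ('I_d * 'I_n)%type) _ (barW x n p y) (barW_linearr y).

Definition barWl (y : q) : {linear {poly K} -> sym K ('I_d * 'I_n)%type} :=
  barW x n p y.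

Lemma barW_linearl r : linear (fun y => barW x n p y r).
Proof. by apply: linear_combr => k; apply: elt_linear. Qed.

Lemma barW_dvdp y r : p %| r -> barW x n p y r = 0.
Proof.
by move=> /modp_eq0P pr; apply: big1 => k _; rewrite pr coef0 scale0r.
Qed.

Lemma barW_Xn (j : 'I_d) (k : 'I_n) : barW x n p x`_j 'X^k = svar K (j, k).
Proof.
apply: etrans (sum_delta k (fun k => svar K (j, k))).
apply: eq_bigr => l _; rewrite elt_x modp_small ?coefXn //.
by rewrite size_polyXn size_p ltnS.
Qed.

Lemma sderiv_barW u (j : 'I_d) r :
  sderiv (bracketW x p u) (barW x n p x`_j r)
    = barW x n p (lie x`_u.1 x`_j) ('X^(u.2) * r).
Proof.
rewrite [RHS](modp_comb r (L := barWl _) u.2 size_p (barW_dvdp _)).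
rewrite linear_sum; apply: eq_bigr => k _; rewrite linearZ.
by congr (_ *: _); rewrite elt_x; apply: sderiv_svar.
Qed.

Lemma barW_lie (i j : 'I_d) r :
  barW x n p (lie x`_i x`_j) r = \sum_k str i j k *: barW x n p x`_k r.
Proof.
pose f : {linear q -> sym K ('I_d * 'I_n)%type} :=
  HB.pack (fun y => barW x n p y r) (GRing.isLinear.Build _ _ _ _ _
    (barW_linearl r)).
rewrite -[LHS]/(f _) lieE linear_sum; apply: eq_bigr => k _.
by rewrite linearZ.
Qed.

Lemma bracketW_anti (u v : 'I_d * 'I_n) : bracketW x p u v = - bracketW x p v u.
Proof.
pose f r : {linear q -> sym K ('I_d * 'I_n)%type} :=
  HB.pack (fun y => barW x n p y r) (GRing.isLinear.Build _ _ _ _ _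
    (barW_linearl r)).
rewrite /bracketW addnC -[LHS]/(f _ _) lie_anti; apply: etrans (raddfN _ _) _.
by [].
Qed.

End Quotient.
End StructureConstants.

Section Leibniz.
Variables (K : fieldType) (A : comAlgType K) (d : nat).
Variable e : 'I_d -> {linear {poly K} -> A}.

Lemma bil_delta r s : bil e (fun j k => (k == j)%:R) r s = \sum_j e j r * e j s.
Proof. by apply: eq_bigr => j _;
  rewrite (sum_delta j (fun k => e j r * e k s)). Qed.

Lemma bil_leibniz (M : 'I_d -> 'I_d -> K) r r' s s' :
  (forall j k, M j k = - M k j) ->
  \sum_j ((\sum_k M j k *: e k r') * e j s + e j r * (\sum_k M j k *: e k s'))
    = bil e M r s' - bil e M r' s.
Proof.
move=> M_anti; rewrite big_split /= [LHS]addrC; congr (_ + _).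
  apply: eq_bigr => j _; rewrite mulr_sumr; apply: eq_bigr => k _.
  by rewrite -scalerAr.
rewrite /bil exchange_big -sumrN; apply: eq_bigr => j _.
rewrite mulr_suml -sumrN; apply: eq_bigr => k _.
by rewrite M_anti scaleNr mulNr scalerAl.
Qed.

End Leibniz.

Lemma char0_two (K : fieldType) : [pchar K] =i pred0 -> 2%:R != 0 :> K.
Proof. by move/pcharf0P->. Qed.

Lemma eqN_eq0 (K : fieldType) (V : lmodType K) (v : V) :
  2%:R != 0 :> K -> v = - v -> v = 0.
Proof.
move=> two v_opp; have /eqP : 2%:R *: v = 0.
  by rewrite scaler_nat mulr2n {1}v_opp addNr.
by rewrite scaler_eq0 (negPf two) => /eqP.
Qed.

(** * Quadratic elements and their brackets with the generators *)

Section QuadraticElements.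
Variables (K : fieldType) (q : lieAlgType K) (B : {symmetric q}).
Variables (d : nat) (x : d.-tuple q).
Hypothesis xbasis : basis_of fullv x.
Hypothesis xortho : forall i j : 'I_d, B x`_i x`_j = (i == j)%:R.
Hypothesis Binv : forall w y z, B (lie w y) z + B y (lie w z) = 0.
Variables (p : {poly K}) (n : nat).
Hypothesis size_p : size p = n.+1.

Notation W := (sym K ('I_d * 'I_n)%type).
Let e (j : 'I_d) : {linear {poly K} -> W} := barWl x p n x`_j.
Let c := str B x.

Lemma e_dvdp j r : p %| r -> e j r = 0.
Proof. exact: barW_dvdp. Qed.

Lemma hbarE r s : hbar x n p r s = bil e (fun j k => (k == j)%:R) r s.
Proof. exact/esym/bil_delta. Qed.

Lemma hbar_hmon (a b : 'I_n) : hbar x n p 'X^a 'X^b = hmon K d a b.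
Proof. by apply: eq_bigr => i _; rewrite !barW_Xn. Qed.

Lemma sderiv_hbar u r s :
  sderiv (bracketW x p u) (hbar x n p r s)
    = bil e (c u.1) r ('X^(u.2) * s) - bil e (c u.1) ('X^(u.2) * r) s.
Proof.
rewrite -(bil_leibniz _ _ _ _ _ (str_antir x Binv u.1)) linear_sum.
apply: eq_bigr => j _; apply: etrans (sderivM _ _ _) _.
have D t : sderiv (bracketW x p u) (e j t) = \sum_k c u.1 j k *: e k ('X^(u.2)
  * t).
  by apply: etrans (sderiv_barW xbasis size_p u j t) (barW_lie xbasis xortho p
    n _ _ _).
exact: (f_equal2 (fun a b => a * e j s + e j r * b) (D r) (D s)).
Qed.

Definition hquad (S : nat -> nat -> K) : W :=
  \sum_(a < n) \sum_(b < n) S a b *: hmon K d a b.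

Lemma sderiv_hquad u S :
  sderiv (bracketW x p u) (hquad S)
    = \sum_(a < n) \sum_(b < n) S a b *:
        (bil e (c u.1) 'X^a ('X^(u.2) * 'X^b)
         - bil e (c u.1) ('X^(u.2) * 'X^a) 'X^b).
Proof.
rewrite linear_sum; apply: eq_bigr => a _; rewrite linear_sum.
apply: eq_bigr => b _; rewrite linearZ; congr (_ *: _).
by rewrite -hbar_hmon; apply: sderiv_hbar.
Qed.

Lemma Zquot_hquad S (g : {poly K}) : (size g <= n.+1)%N ->
  (forall a b, (n <= a)%N || (n <= b)%N -> S a b = 0) ->
  (forall a b, xy_mul S a b = wedge p g a b) -> Zquot x p (hquad S).
Proof.
move=> size_g S0 S_mul; apply: poisson_centerP; first exact: bracketW_anti.
by move=> u; rewrite sderiv_hquad (bil_central size_p e_dvdp _ size_g).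
Qed.

Lemma poisson_hquad (o : 'I_n) S :
  poisson (bracketW x p) (hmon K d o o) (hquad S)
    = \sum_i (sderiv (bracketW x p (i, o)) (hquad S) * svar K (i, o)
              + svar K (i, o) * sderiv (bracketW x p (i, o)) (hquad S)).
Proof.
rewrite /poisson linear_sum; apply: eq_bigr => i _.
by apply: etrans (sderivM _ _ _) _; rewrite !sderiv_svar.
Qed.

End QuadraticElements.

(** * The dimension of the Poisson centraliser *)

Section FirstShift.
Variables (K : fieldType) (A : comAlgType K) (d : nat).
Variable e : 'I_d -> {linear {poly K} -> A}.
Variables (p : {poly K}) (n : nat).
Hypothesis size_p : size p = n.+1.
Hypothesis e_dvdp : forall j r, p %| r -> e j r = 0.

(** The factor y - x turns S into -(x - y) S, of which only the remainder F survives modulo p. The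
    indices of (x - y) S reach n, whence the conditions on row and column n of F. *)
Lemma bil_shift1 (S F : nat -> nat -> K) (g : {poly K}) M :
  (size g <= n.+1)%N ->
  (forall a b, (n <= a)%N || (n <= b)%N -> S a b = 0) ->
  (forall a b, xy_mul S a b = wedge p g a b + F a b) ->
  (forall a, F a n = 0) -> (forall b, F n b = 0) ->
  \sum_(a < n) \sum_(b < n)
     S a b *: (bil e M 'X^a ('X^1 * 'X^b) - bil e M ('X^1 * 'X^a) 'X^b)
    = - \sum_(a < n) \sum_(b < n) F a b *: bil e M 'X^a 'X^b.
Proof.
move=> size_g S0 S_mul Fan Fnb; apply/eqP; rewrite -eqr_oppLR -sumrN; apply/eqP.
under eq_bigr do rewrite -sumrN.
under eq_bigr do under eq_bigr do rewrite -scalerN opprB -!exprD !add1n.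
rewrite (xy_mul_sum (fun a b => bil e M 'X^a 'X^b) S0).
under eq_bigr do under eq_bigr do rewrite S_mul scalerDl.
under eq_bigr do rewrite big_split.
rewrite big_split /= [X in X + _](_ : _ = 0) ?add0r.
  rewrite big_ord_recr /= [X in _ + X]big1 ?addr0 => [|b _];
    last by rewrite Fnb scale0r.
  apply: eq_bigr => a _; rewrite big_ord_recr /= Fan scale0r addr0.
  by apply: eq_bigr.
have /esym := wedge_bil e M 1 1 (eq_leq size_p) size_g.
rewrite !mul1r (bil_dvdl e_dvdp) // (bil_dvdr e_dvdp) // subrr => e0;
  rewrite [RHS]e0.
by apply: eq_bigr => a _; apply: eq_bigr => b _; rewrite !mul1r.
Qed.

(** By antisymmetry of each c i, the sum is -4 times an alternating trilinear expression with r in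
    two of its three slots. *)
Lemma sum_alternating (c : 'I_d -> 'I_d -> 'I_d -> K) (T : 'I_d -> A) r s :
  2%:R != 0 :> K ->
  (forall i j k, c j i k = - c i j k) -> (forall i j k, c i j k = - c i k j) ->
  (forall i, T i = - (bil e (c i) r s - bil e (c i) s r)) ->
  \sum_i (T i * e i r + e i r * T i) = 0.
Proof.
move=> two c_antil c_antir TE; set Z := \sum_i e i r * bil e (c i) r s.
have Z0 : Z = 0.
  apply: (eqN_eq0 two); rewrite /Z /bil.
  under eq_bigr => i _ do rewrite mulr_sumr.
  rewrite {2}exchange_big /= -sumrN; apply: eq_bigr => i _.
  rewrite -sumrN; apply: eq_bigr => j _; rewrite !mulr_sumr -sumrN.
  apply: eq_bigr => k _.
  by rewrite c_antil scaleNr mulrN -!scalerAr mulrCA.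
rewrite (eq_bigr (fun i => (e i r * bil e (c i) r s) *- 4)).
  by rewrite sumrN sumrMnl -/Z Z0 mul0rn oppr0.
move=> i _; rewrite TE [bil e (c i) s r]bil_anti // opprK -mulr2n.
by rewrite [_ * e i r]mulrC -mulr2n mulrN mulrnAr !mulNrn -mulrnA.
Qed.

End FirstShift.

(** Polarisation: basis vectors give the diagonal entries, and sums of two of them give 2 S a b. *)
Lemma sum_scale_delta (K : fieldType) n (S : 'I_n -> 'I_n -> K) :
  (forall l : 'I_n -> K, \sum_a \sum_b S a b * (l a * l b) = 0) ->
  (forall a b, S a b = S b a) -> 2%:R != 0 :> K -> forall a b, S a b = 0.
Proof.
move=> S0 S_sym two a b; pose D (c : 'I_n) i : K := (i == c)%:R.
pose Phi (u v : 'I_n -> K) := \sum_a \sum_b S a b * (u a * v b).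
have PhiE c c' : Phi (D c) (D c') = S c c'.
  rewrite /Phi (bigD1 c) //= (bigD1 c') //= /D !eqxx !mulr1 !big1 ?addr0 //.
    by move=> i /negPf ic; rewrite big1 // => j _; rewrite ic mul0r mulr0.
  by move=> j /negPf ->; rewrite mulr0 mulr0.
have PhiD u v w z : Phi (fun i => u i + v i) (fun i => w i + z i)
    = Phi u w + Phi u z + (Phi v w + Phi v z).
  rewrite /Phi -!big_split; apply: eq_bigr => i _; rewrite -!big_split.
  by apply: eq_bigr => j _ /=; rewrite mulrDl !mulrDr.
have := S0 (fun i => D a i + D b i); rewrite -/(Phi _ _) PhiD !PhiE.
have diag c : S c c = 0 by rewrite -(PhiE c c) /Phi S0.
rewrite !diag add0r addr0 [S b a]S_sym -mulr2n -mulr_natr => /eqP.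
by rewrite mulf_eq0 (negPf two) orbF => /eqP.
Qed.

(* The value of an alternating cubic form at the point with the basis vectors *)
(* i0, j0, k0 in the levels o, a0, b0 and zero in the other levels.           *)
Lemma sum_two_levels (K : fieldType) n (J : eqType) (F : 'I_n -> 'I_n -> K)
    (M : J -> J -> K) (o a0 b0 : 'I_n) (i0 j0 k0 : J) :
  a0 != b0 -> a0 != o -> b0 != o ->
  (forall j, M i0 j = 0) -> (forall j, M j i0 = 0) -> (forall j, M j j = 0) ->
  let w a := if a == o then i0 else if a == a0 then j0 else k0 in
  let lv a := [|| a == o, a == a0 | a == b0] in
  \sum_a \sum_b F a b * ((lv a && lv b)%:R * M (w a) (w b))
    = F a0 b0 * M j0 k0 + F b0 a0 * M k0 j0.
Proof.
move=> ab /negPf ao /negPf bo Ml Mr Md w lv.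
pose G a := \sum_b F a b * ((lv a && lv b)%:R * M (w a) (w b)).
rewrite -[LHS]/(\sum_a G a) (bigD1 a0) //= (bigD1 b0) 1?eq_sym //= big1;
  last first.
  move=> a /andP[/negPf aa0 /negPf ab0]; rewrite /G big1 // => b _.
  by rewrite /lv /w aa0 ab0 orbF; case: eqP => _;
    rewrite ?Ml ?mulr0 // mul0r mulr0.
rewrite /G /lv /w {G lv w}.
rewrite addr0; congr (_ + _).
  rewrite (bigD1 b0) //= !eqxx ao bo ![b0 == a0]eq_sym (negPf ab) !orbT mul1r.
  rewrite big1 ?addr0 // => b /negPf bb0; rewrite bb0 orbF.
  case: eqP => _; first by rewrite Mr !mulr0.
  by case: eqP => _; rewrite ?Md ?mulr0 // mul0r mulr0.
rewrite (bigD1 a0) //= !eqxx ao bo ![b0 == a0]eq_sym (negPf ab) !orbT mul1r.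
rewrite big1 ?addr0 // => b /negPf bb0; rewrite bb0 /=.
case: eqP => _; first by rewrite Mr !mulr0.
by case: eqP => _; rewrite ?Md ?mulr0 // mul0r mulr0.
Qed.

(** * Arrays S with prescribed product (x - y) S *)

Section Solutions.
Variables (K : fieldType) (p : {poly K}) (n : nat).
Hypothesis two : 2%:R != 0 :> K.
Hypothesis size_p : size p = n.+1.
Hypothesis p_monic : p \is monic.
Hypothesis n_ge2 : (2 <= n)%N.
Implicit Types (f g : {poly K}) (S : nat -> nat -> K).

(* The S such that (x - y) S = p(x)g(y) - p(y)g(x) + x f(y) - y f(x).         *)
Definition sol_rhs g f a b : K := wedge p g a b + wedge 'X f a b.
Definition sol g f : nat -> nat -> K := xy_div (sol_rhs g f).

Lemma sol_rhs_anti g f a b : sol_rhs g f a b = - sol_rhs g f b a.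
Proof. by rewrite /sol_rhs (wedge_anti p) (wedge_anti 'X) [RHS]opprD. Qed.

Lemma sol_rhs_supp g f : (size g <= n)%N -> (size f <= n)%N ->
  forall a b, (n < b)%N -> sol_rhs g f a b = 0.
Proof.
move=> sg sf a b nb; rewrite /sol_rhs /wedge.
rewrite [p`_b]nth_default ?size_p // [g`_b]nth_default ?(leq_trans sg) 1?ltnW
  //.
rewrite [f`_b]nth_default ?(leq_trans sf) 1?ltnW //.
have b1 : (b == 1)%N = false by rewrite gtn_eqF // (leq_trans n_ge2) // ltnW.
by rewrite !coefX b1 !mulr0 !mul0r !subr0 addr0.
Qed.

Section Sized.
Variables (g f : {poly K}).
Hypotheses (sg : (size g <= n)%N) (sf : (size f <= n)%N).

Lemma sol_sym a b : sol g f a b = sol g f b a.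
Proof. exact: (xy_div_sym two (sol_rhs_anti g f)). Qed.

Lemma sol_supp a b : (n <= a)%N || (n <= b)%N -> sol g f a b = 0.
Proof. exact: (xy_div_supp two (sol_rhs_anti g f) (sol_rhs_supp sg sf)). Qed.

Lemma sol_mul a b : xy_mul (sol g f) a b = sol_rhs g f a b.
Proof. exact: (xy_divK two (sol_rhs_anti g f)). Qed.

(** Since p is monic of degree n >= 2, row n of the right-hand side is g; once g = 0, row 1 is f.
    The normalisation of f_1 is forced by [wedge 'X 'X] being zero. *)
Lemma sol_eq0 : f`_1 = 0 -> (forall a b, sol g f a b = 0) -> g = 0 /\ f = 0.
Proof.
move=> f1 sol0.
have rhs0 a b : sol_rhs g f a b = 0.
  by rewrite -sol_mul /xy_mul; case: a b => [|a] [|b]; rewrite ?sol0 subrr.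
have pn : p`_n = 1 by have /eqP := p_monic; rewrite lead_coefE size_p.
have Xn : ('X : {poly K})`_n = 0 by rewrite coefX gtn_eqF.
have fn : f`_n = 0 by rewrite nth_default.
have gn : g`_n = 0 by rewrite nth_default.
have g0 : g = 0.
  apply/polyP=> b; rewrite coef0 -[RHS](rhs0 n b) /sol_rhs /wedge pn Xn fn gn.
  by rewrite mul1r !mulr0 mul0r !subr0 addr0.
split=> //; apply/polyP=> b;
  rewrite coef0 -[RHS](rhs0 1%N b) /sol_rhs /wedge g0 !coef0.
by rewrite f1 !coefX mul1r !mulr0 !subr0 add0r.
Qed.

End Sized.

(** Division with remainder by p(x) and p(y): taking the last column of S for g cancels row and
    column n of (x - y) S, leaving F. The last clause is conditional because the vanishing of F away
    from row and column 1 must come from the Poisson condition. *)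
Lemma sol_exists S :
  (forall a b, S a b = S b a) ->
  (forall a b, (n <= a)%N || (n <= b)%N -> S a b = 0) ->
  exists2 g : {poly K}, (size g <= n)%N & exists F : nat -> nat -> K,
   [/\ forall a b, xy_mul S a b = wedge p g a b + F a b,
       forall a b, F a b = - F b a,
       forall a b, (n <= a)%N || (n <= b)%N -> F a b = 0
     & (forall a b : nat, (a < n)%N -> (b < n)%N -> a != b -> a != 1%N -> b !=
       1%N ->
          F a b = 0) ->
       exists f : {poly K}, [/\ (size f <= n)%N, f`_1 = 0 & S =2 sol g f]].
Proof.
move=> S_sym S0; pose g := \poly_(a < n) S a n.-1.
exists g; first exact: size_poly.
pose F a b := xy_mul S a b - wedge p g a b.
have pn : p`_n = 1 by have /eqP := p_monic; rewrite lead_coefE size_p.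
have gE a : g`_a = S a n.-1.
  by rewrite coef_poly; case: ltnP => // na; rewrite S0 ?na.
have mul_anti a b : xy_mul S a b = - xy_mul S b a.
  rewrite /xy_mul opprB; congr (_ - _).
    by case: a => // a; rewrite S_sym.
  by case: b => // b; rewrite S_sym.
have F_anti a b : F a b = - F b a.
  by rewrite /F mul_anti wedge_anti -opprD.
have F0 a b : (n <= b)%N -> F a b = 0.
  move=> nb; have b_gt0 : (0 < b)%N by apply: leq_trans nb; apply: ltnW.
  rewrite /F /xy_mul /wedge -(prednK b_gt0) /= !gE [S b.-1.+1 _]S0 ?prednK ?nb
    // mulr0 sub0r opprK.
  have -> : (if a is a'.+1 then S a' b else 0) = 0.
    by case: a => // a; rewrite S0 ?nb ?orbT.
  rewrite sub0r; case: (ltngtP n b) nb => // [ltnb _|<- _];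
    last by rewrite pn mul1r addNr.
  have -> : p`_b = 0 by rewrite nth_default // size_p.
  by rewrite S0 ?mul0r ?oppr0 ?addr0 //; apply/orP; right; lia.
exists F; split => // [a b|a b /orP[na|nb]|Fab0].
- by rewrite /F addrC subrK.
- by rewrite F_anti F0 ?oppr0.
- exact: F0.
have Fd a : F a a = 0 by apply: (eqN_eq0 (V := K^o) two); apply: F_anti.
(* An alternating array supported on row and column 1 is [wedge 'X f], with f read off row 1; its
   entry f_1 = F 1 1 is zero. *)
pose f := \poly_(b < n) F 1%N b.
have fE b : f`_b = F 1%N b by rewrite coef_poly; case: ltnP => // nb;
  rewrite F0.
exists f; split=> [||a b]; [exact: size_poly|by rewrite fE|].
rewrite -[LHS]xy_mulK; apply: eq_xy_div => {}a {}b.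
rewrite /sol_rhs -[LHS](subrK (wedge p g a b)) [RHS]addrC -/(F a b);
  congr (_ + _).
rewrite /wedge !coefX !fE.
have [->|a1] := eqVneq a 1%N.
  rewrite mul1r; have [->|b1] := eqVneq b 1%N; first by rewrite Fd mul1r subrr.
  by rewrite mul0r subr0.
rewrite mul0r sub0r; have [->|b1] := eqVneq b 1%N;
  first by rewrite mul1r F_anti.
rewrite mul0r oppr0; have [->|ab] := eqVneq a b; first by rewrite Fd.
case: (ltnP b n) => [bn|nb]; last by rewrite F0.
case: (ltnP a n) => [an|na]; last by rewrite F_anti F0 ?oppr0.
exact: Fab0.
Qed.

End Solutions.

Section Extension.
Variables (K : fieldType) (n : nat) (C : 'I_n -> 'I_n -> K).

Definition ext a b : K :=
  if insub a is Some i then if insub b is Some j then C i j else 0 else 0.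

Lemma ext_ord (a b : 'I_n) : ext a b = C a b.
Proof. by rewrite /ext !valK. Qed.

Lemma ext_supp a b : (n <= a)%N || (n <= b)%N -> ext a b = 0.
Proof.
rewrite /ext => /orP[] le; last by case: insub => // i;
  rewrite insubN // -leqNgt.
by rewrite insubN // -leqNgt.
Qed.

Lemma ext_sym : (forall a b, C a b = C b a) -> forall a b, ext a b = ext b a.
Proof. by move=> C_sym a b; rewrite /ext; case: insub => [i|]; case: insub. Qed.

End Extension.

(** * The centraliser condition, tested by evaluation at points *)

Section FirstPart.
Variables (K : fieldType) (q : lieAlgType K) (B : {symmetric q}).
Variables (d : nat) (x : d.-tuple q).
Hypothesis xbasis : basis_of fullv x.
Hypothesis xortho : forall i j : 'I_d, B x`_i x`_j = (i == j)%:R.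
Hypothesis Binv : forall w y z, B (lie w y) z + B y (lie w z) = 0.
Hypothesis two : 2%:R != 0 :> K.
Variables (p : {poly K}) (n : nat).
Hypothesis size_p : size p = n.+1.
Hypothesis p_monic : p \is monic.
Hypothesis n_ge2 : (2 <= n)%N.

Notation W := (sym K ('I_d * 'I_n)%type).
Let e (j : 'I_d) : {linear {poly K} -> W} := barWl x p n x`_j.
Let c := str B x.
Let o1 := Ordinal n_ge2.

Lemma hmon_sym (a b : 'I_n) : hmon K d a b = hmon K d b a.
Proof. by apply: eq_bigr => i _; apply: mulrC. Qed.

(** As h[a, b] = h[b, a], coefficients may be averaged over the transposition; the division argument
    needs them symmetric. *)
Lemma in_span_hquad (H : W) : in_span_h H ->
  exists C : 'I_n -> 'I_n -> K, (forall a b, C a b = C b a) /\ H = hquad d n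
    (ext C).
Proof.
case=> C ->; exists (fun a b => 2%:R^-1 * (C a b + C b a)).
split=> [a b|]; first by rewrite addrC.
pose h (a b : 'I_n) := hmon K d a b; rewrite /hquad -/h.
under [RHS]eq_bigr do under eq_bigr do rewrite ext_ord.
have gen (V : lmodType K) (g : 'I_n -> 'I_n -> V) : (forall a b, g a b = g b a)
  ->
    \sum_a \sum_b C a b *: g a b = \sum_a \sum_b (2%:R^-1 * (C a b + C b a)) *:
      g a b.
  move=> g_sym; set T := LHS.
  have T2 : T = 2%:R^-1 *: (T + \sum_a \sum_b C b a *: g a b).
    rewrite (exchange_big _ _ _ _ _ _) /=.
    rewrite (eq_bigr (fun a => \sum_b C a b *: g a b)); last first.
      by move=> a _; apply: eq_bigr => b _; rewrite g_sym.
    by rewrite -/T -mulr2n -scaler_nat scalerA mulVf ?scale1r.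
  rewrite {1}T2 /T -big_split scaler_sumr; apply: eq_bigr => a _ /=.
  rewrite -big_split scaler_sumr; apply: eq_bigr => b _ /=.
  by rewrite -scalerDl scalerA.
exact: (gen _ h hmon_sym).
Qed.

Let ev (y : 'I_d * 'I_n -> K) : {lrmorphism W -> K^o} := seval (A := K^o) y.

Lemma ev_svar y v : ev y (svar K v) = y v.
Proof. exact: seval_svar. Qed.

Lemma evD y (F G : W) : ev y (F + G) = ev y F + ev y G.
Proof. exact: rmorphD. Qed.

Lemma evM y (F G : W) : ev y (F * G) = ev y F * ev y G.
Proof. exact: rmorphM. Qed.

Lemma ev_hquad y S :
  ev y (hquad d n S) = \sum_(a < n) \sum_(b < n) S a b * \sum_i y (i, a) * y
    (i, b).
Proof.
rewrite linear_sum; apply: eq_bigr => a _; rewrite linear_sum.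
apply: eq_bigr => b _; rewrite linearZ; congr (_ * _); rewrite linear_sum.
by apply: eq_bigr => i _; rewrite -!ev_svar; apply: rmorphM.
Qed.

Lemma ev_bil y M (a b : 'I_n) :
  ev y (bil e M 'X^a 'X^b) = \sum_j \sum_k M j k * (y (j, a) * y (k, b)).
Proof.
rewrite linear_sum; apply: eq_bigr => j _; rewrite linear_sum.
apply: eq_bigr => k _; rewrite linearZ; congr (_ * _).
rewrite -!ev_svar -(barW_Xn xbasis size_p j a) -(barW_Xn xbasis size_p k b).
exact: rmorphM.
Qed.

(** At points involving only x_i0, [hquad S] takes the values of the quadratic form with matrix
    S. *)
Lemma hquad_inj (S : nat -> nat -> K) (i0 : 'I_d) :
  (forall a b, S a b = S b a) ->
  (forall a b, (n <= a)%N || (n <= b)%N -> S a b = 0) ->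
  hquad d n S = 0 -> forall a b, S a b = 0.
Proof.
move=> S_sym S0 HS0.
have Sord : forall a b : 'I_n, S a b = 0.
  apply: (sum_scale_delta (S := fun a b : 'I_n => S a b)) => // l.
  have := ev_hquad (fun v => (v.1 == i0)%:R * l v.2) S.
  rewrite HS0 linear0 => e0; rewrite [RHS]e0; apply: eq_bigr => a _.
  apply: eq_bigr => b _; congr (_ * _);
    rewrite (bigD1 i0) //= eqxx !mul1r big1 ?addr0 //.
  by move=> i /negPf ->; rewrite !mul0r.
move=> a b; have [na|an] := leqP n a; first by rewrite S0 ?na.
have [nb|bn] := leqP n b; first by rewrite S0 ?nb ?orbT.
exact: (Sord (Ordinal an) (Ordinal bn)).
Qed.

Lemma sderiv_hquad1 i (S F : nat -> nat -> K) (g : {poly K}) :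
  (size g <= n.+1)%N ->
  (forall a b, (n <= a)%N || (n <= b)%N -> S a b = 0) ->
  (forall a b, xy_mul S a b = wedge p g a b + F a b) ->
  (forall a, F a n = 0) -> (forall b, F n b = 0) ->
  sderiv (bracketW x p (i, o1)) (hquad d n S)
    = - \sum_(a < n) \sum_(b < n) F a b *: bil e (c i) 'X^a 'X^b.
Proof.
move=> sg S0 SF Fan Fnb.
apply: etrans (sderiv_hquad xbasis xortho Binv size_p (i, o1) S) _.
exact: (bil_shift1 size_p (@e_dvdp _ _ _ _ _ _) (c i) sg S0 SF Fan Fnb).
Qed.

(** The remainder of (x - y) S is [wedge 'X f], so {h, H} is a multiple of the alternating cubic
    expression at t, t, f. *)
Lemma Ph_sol (g f : {poly K}) : (size g <= n)%N -> (size f <= n)%N ->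
  Ph x o1 p (hquad d n (sol p g f)).
Proof.
move=> sg sf; split.
  by exists (fun a b => sol p g f a b).
apply: etrans (poisson_hquad _ _ _ _) _.
have Xf b : wedge 'X f n b = - f`_n * ('X : {poly K})`_b.
  by rewrite /wedge coefX gtn_eqF // mul0r sub0r mulNr mulrC.
have fn : f`_n = 0 by rewrite nth_default.
have TE i : sderiv (bracketW x p (i, o1)) (hquad d n (sol p g f))
    = - (bil e (c i) 'X f - bil e (c i) f 'X).
  rewrite (sderiv_hquad1 i (F := wedge 'X f) (leqW sg) (sol_supp two size_p
    n_ge2 sg sf)
             (sol_mul p two g f)); last 2 first.
  - by move=> a; rewrite wedge_anti Xf fn oppr0 mul0r oppr0.
  - by move=> b; rewrite Xf fn oppr0 mul0r.
  congr (- _); have sX : (size ('X : {poly K}) <= n)%N by rewrite size_polyX.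
  have := wedge_bil e (c i) 1 1 sX sf; rewrite !mul1r => <-.
  by apply: eq_bigr => a _; apply: eq_bigr => b _; rewrite !mul1r.
have vE i : svar K (i, o1) = e i 'X by rewrite -(barW_Xn xbasis size_p i o1).
rewrite -[RHS](sum_alternating (e := e) two (str_antil B x) (str_antir x Binv)
  TE).
by apply: eq_bigr => i _; rewrite vE.
Qed.

Lemma Ph_hquad (S : nat -> nat -> K) (i0 j0 k0 : 'I_d) : c i0 j0 k0 != 0 ->
  (forall a b, S a b = S b a) ->
  (forall a b, (n <= a)%N || (n <= b)%N -> S a b = 0) ->
  poisson (bracketW x p) (hmon K d o1 o1) (hquad d n S) = 0 ->
  exists g f : {poly K},
    [/\ (size g <= n)%N, (size f <= n)%N, f`_1 = 0 & S =2 sol p g f].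
Proof.
move=> c0 S_sym S0 PS0.
have [g sg [F [SF F_anti F0 solF]]] := sol_exists two size_p p_monic n_ge2
  S_sym S0.
suff /solF[f [sf f1 Sf]] : forall a b : nat, (a < n)%N -> (b < n)%N ->
  a != b -> a != 1%N -> b != 1%N -> F a b = 0 by exists g, f.
move=> a b an bn ab a1 b1.
pose a0 := Ordinal an; pose b0 := Ordinal bn.
pose w (l : 'I_n) := if l == o1 then i0 else if l == a0 then j0 else k0.
pose lv (l : 'I_n) := [|| l == o1, l == a0 | l == b0].
(* The point with coordinate 1 at x_i0 t, x_j0 t^a, x_k0 t^b and 0 elsewhere. There {h, H} takes the
   value -4 F a b c_(i0 j0 k0). *)
pose y (v : 'I_d * 'I_n) : K := (lv v.2 && (v.1 == w v.2))%:R.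
have y1 i : y (i, o1) = (i == i0)%:R by rewrite /y /lv /w /=.
pose T i := sderiv (bracketW x p (i, o1)) (hquad d n S).
have cd i j : c i i j = 0.
  exact: (eqN_eq0 (V := K^o) two (str_antil B x i i j)).
have cd' i j : c i j j = 0.
  exact: (eqN_eq0 (V := K^o) two (str_antir x Binv i j j)).
have evT : ev y (T i0) = - (F a b * c i0 j0 k0 + F b a * c i0 k0 j0).
  rewrite /T (sderiv_hquad1 i0 (leqW sg) S0 SF) => [|l|l];
    try by rewrite F0 ?leqnn ?orbT.
  rewrite linearN; congr (- _).
  have <- := @sum_two_levels _ n _ (fun l m => F l m) (c i0) o1 a0 b0 i0 j0 k0
    ab a1 b1
    (cd i0) _ (cd' i0); last first.
    by move=> j; apply: etrans (str_antir x Binv i0 j i0) _;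
      rewrite -/c cd oppr0.
  rewrite linear_sum; apply: eq_bigr => l _; rewrite linear_sum.
  apply: eq_bigr => m _; rewrite linearZ; congr (_ * _).
  apply: etrans (ev_bil y (c i0) l m) _; rewrite -/(lv l) -/(lv m).
  rewrite -/(w l) -/(w m) (bigD1 (w l)) //= (bigD1 (w m)) //= big1 ?addr0.
    rewrite big1 ?addr0 /y /= => [|j /negPf jl]; last first.
      by rewrite big1 // => k _; rewrite jl andbF mul0r mulr0.
    by rewrite !eqxx !andbT -natrM mulnb mulrC.
  by move=> k /negPf km; rewrite /y /= km andbF !mulr0.
have : ev y (poisson (bracketW x p) (hmon K d o1 o1) (hquad d n S)) = ev y (T
  i0) *+ 2.
  rewrite poisson_hquad linear_sum.
  rewrite (eq_bigr (fun i => (i == i0)%:R *: (ev y (T i) *+ 2))) ?sum_delta //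
    => i _.
  have yi : ev y (svar K (i, o1)) = (i == i0)%:R by rewrite ev_svar.
  apply: etrans (evD _ _ _) _.
  apply: etrans (f_equal2 +%R (evM _ _ _) (evM _ _ _)) _; rewrite yi.
  by move: (ev y (T i)) => t; rewrite [X in X + _]mulrC -mulr2n -mulrnAr.
have e2 : c i0 k0 j0 = - c i0 j0 k0 := str_antir x Binv i0 k0 j0.
rewrite PS0 linear0 evT (F_anti b a) e2 mulrNN -mulr2n => /esym/eqP.
rewrite -mulr_natr mulf_eq0 (negPf two) orbF oppr_eq0 -mulr_natr.
by rewrite !mulf_eq0 (negPf c0) (negPf two) !orbF => /eqP.
Qed.

End FirstPart.

(** * A basis of the space of parameters (g, f) *)

Section Coordinates.
Variables (K : fieldType) (n : nat) (o1 : 'I_n).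
Hypothesis o1E : o1 = 1%N :> nat.

(** [lift o1] enumerates the exponents other than 1, since x f(y) - y f(x) does not depend on
    f_1. *)
Definition param (i : 'I_(n + n.-1)) : {poly K} * {poly K} :=
  match split i with inl a => ('X^a, 0) | inr j => (0, 'X^(lift o1 j)) end.

Definition param_comb (c : 'I_(n + n.-1) -> K) : {poly K} * {poly K} :=
  (\sum_(a < n) c (lshift _ a) *: 'X^a, \sum_(j < n.-1) c (rshift _ j) *:
    'X^(lift o1 j)).

Lemma param_combE c : \sum_i c i *: param i = param_comb c.
Proof.
have pl a : param (lshift _ a) = ('X^a, 0) by rewrite /param (unsplitK (inl a)).
have pr j : param (rshift _ j) = (0, 'X^(lift o1 j)) by rewrite /param
  (unsplitK (inr j)).
rewrite [LHS]surjective_pairing /param_comb (raddf_sum fst) (raddf_sum snd) /=.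
rewrite !big_split_ord /=; congr (_, _).
  rewrite [X in _ + X]big1 ?addr0 => [|j _]; last by rewrite pr scaler0.
  by apply: eq_bigr => a _; rewrite pl.
rewrite big1 ?add0r => [|a _]; last by rewrite pl scaler0.
by apply: eq_bigr => j _; rewrite pr.
Qed.

Lemma coef_ord_comb m (c : 'I_m -> K) (h : 'I_m -> nat) k : 
  (\sum_(a < m) c a *: 'X^(h a))`_k = \sum_(a < m | h a == k) c a.
Proof.
rewrite coef_sum [RHS]big_mkcond; apply: eq_bigr => a _.
by rewrite coefZ coefXn eq_sym; case: eqP; rewrite ?mulr1 ?mulr0.
Qed.

Lemma size_ord_comb m (c : 'I_m -> K) (h : 'I_m -> nat) :
  (forall a, (h a < n)%N) -> (size (\sum_(a < m) c a *: 'X^(h a) : {poly K})%R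
    <= n)%N.
Proof.
move=> hn; apply/leq_sizeP => k nk; rewrite coef_ord_comb big1 // => a /eqP ak.
by have := hn a; rewrite ak ltnNge nk.
Qed.

Lemma param_comb_spec c :
  [/\ (size (param_comb c).1 <= n)%N, (size (param_comb c).2 <= n)%N
    & (param_comb c).2`_1 = 0].
Proof.
split; [exact: (size_ord_comb _ (@ltn_ord n)) | exact: (size_ord_comb _ (fun j
  => ltn_ord (lift o1 j))) |].
rewrite coef_ord_comb big1 // => j /eqP e1.
by have := neq_lift o1 j;
  rewrite -val_eqE /= -[bump _ _]/(lift o1 j : nat) e1 o1E.
Qed.

Lemma param_comb_eq0 c : param_comb c = 0 -> forall i, c i = 0.
Proof.
move=> c0 i; rewrite -(splitK i); case: (split i) => [a|j] /=.
  have := congr1 (fun u : {poly K} * {poly K} => u.1`_a) c0.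
  rewrite coef_ord_comb coef0 => <-; rewrite (bigD1 a) //= big1 ?addr0 //.
  by move=> b /andP[/eqP/val_inj->]; rewrite eqxx.
have := congr1 (fun u : {poly K} * {poly K} => u.2`_(lift o1 j)) c0.
rewrite coef_ord_comb coef0 => <-;
  rewrite (bigD1 j) ?eqxx // big1 => [|b /andP[/eqP e_b bj]];
    first exact/esym/addr0.
by case/eqP: bj; apply/(@lift_inj _ o1)/val_inj.
Qed.

Lemma param_comb_onto (g f : {poly K}) :
  (size g <= n)%N -> (size f <= n)%N -> f`_1 = 0 -> exists c, (g, f) =
    param_comb c.
Proof.
move=> sg sf f1.
exists (fun i => match split i with inl a => g`_a | inr j => f`_(lift o1 j)
  end).
congr (_, _).
  rewrite -[LHS]coefK (@poly_def _ (size g)) (big_ord_widen _ (fun a => g`_a *: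
    'X^a) sg).
  rewrite big_mkcond; apply: eq_bigr => a _; rewrite (unsplitK (inl a)).
  by case: ltnP => // ge; rewrite nth_default // scale0r.
rewrite -[LHS]coefK (@poly_def _ (size f)) (big_ord_widen _ (fun a => f`_a *:
  'X^a) sf).
rewrite big_mkcond (bigD1_ord o1) //= o1E f1 scale0r if_same add0r.
apply: eq_bigr => j _; rewrite (unsplitK (inr j)).
by case: ltnP => // ge; rewrite nth_default // scale0r.
Qed.

End Coordinates.

Section Dimension.
Variables (K : fieldType) (q : lieAlgType K) (B : {symmetric q}).
Variables (d : nat) (x : d.-tuple q).
Hypothesis xbasis : basis_of fullv x.
Hypothesis xortho : forall i j : 'I_d, B x`_i x`_j = (i == j)%:R.
Hypothesis Binv : forall w y z, B (lie w y) z + B y (lie w z) = 0.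
Hypothesis two : 2%:R != 0 :> K.
Hypothesis qnab : exists y z : q, lie y z != 0.
Variables (p : {poly K}) (n : nat).
Hypothesis size_p : size p = n.+1.
Hypothesis p_monic : p \is monic.
Hypothesis n_ge2 : (2 <= n)%N.

Notation W := (sym K ('I_d * 'I_n)%type).

Lemma eq_hquad S1 S2 : S1 =2 S2 -> hquad (K := K) d n S1 = hquad d n S2.
Proof.
by move=> S12; apply: eq_bigr => a _; apply: eq_bigr => b _; rewrite S12.
Qed.

Lemma hquad_linear (c : K) S1 S2 :
  hquad d n (fun a b => c * S1 a b + S2 a b) = c *: hquad d n S1 + hquad d n S2.
Proof.
rewrite scaler_sumr -big_split; apply: eq_bigr => a _ /=.
rewrite scaler_sumr -big_split; apply: eq_bigr => b _ /=.
by rewrite scalerDl scalerA.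
Qed.

Lemma sol_linear (c : K) (g1 f1 g2 f2 : {poly K}) a b :
  sol p (c *: g1 + g2) (c *: f1 + f2) a b = c * sol p g1 f1 a b + sol p g2 f2 a
    b.
Proof.
rewrite /sol /xy_div mulrN -opprD; congr (- _); rewrite mulr_sumr -big_split.
apply: eq_bigr => i _ /=; rewrite /sol_rhs /wedge !coefD !coefZ; ring.
Qed.

Definition hsol (u : {poly K} * {poly K}) : W := hquad d n (sol p u.1 u.2).

Lemma hsol_linear : linear hsol.
Proof.
move=> c u v; rewrite /hsol -hquad_linear; apply: eq_hquad => a b.
exact: sol_linear.
Qed.
HB.instance Definition _ :=
  GRing.isLinear.Build K ({poly K} * {poly K})%type W _ hsol hsol_linear.

Theorem dim_Ph : has_dim (Ph x (Ordinal n_ge2) p) (2 * n - 1).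
Proof.
have -> : (2 * n - 1 = n + n.-1)%N by lia.
pose o1 := Ordinal n_ge2.
have [i0 [j0 [k0 c0]]] := str_neq0 xbasis xortho qnab.
have combE c : \sum_i c i *: hsol (param K o1 i) = hsol (param_comb o1 c).
  rewrite -param_combE linear_sum; apply: eq_bigr => i _.
  by rewrite linearZ.
exists (fun i => hsol (param K o1 i)); split=> [c|H].
  have [sg sf f1] := param_comb_spec (erefl : o1 = 1%N :> nat) c.
  rewrite combE => H0; apply: (param_comb_eq0 (o1 := o1)).
  have sol0 := hquad_inj two i0 (sol_sym p two _ _) (sol_supp two size_p n_ge2
    sg sf) H0.
  have [g0 f0] := sol_eq0 two size_p p_monic n_ge2 sg sf f1 sol0.
  by rewrite [LHS]surjective_pairing g0 f0.
split=> [[/in_span_hquad[//|C [C_sym ->]] PH0]|[c ->]].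
  have [g [f [sg sf f1 solE]]] := Ph_hquad xbasis xortho Binv two size_p
    p_monic c0
    (ext_sym C_sym) (@ext_supp _ _ C) PH0.
  have [c cE] := param_comb_onto (erefl : o1 = 1%N :> nat) sg sf f1.
  by exists c; rewrite combE -cE; apply: eq_hquad.
have [sg sf f1] := param_comb_spec (erefl : o1 = 1%N :> nat) c.
by rewrite combE; apply: Ph_sol.
Qed.

End Dimension.

(** * The pencil of quotients *)

Section Subalgebra.
Variables (K : fieldType) (A : comAlgType K) (G : A -> Prop).

Lemma subalg_genZ c F : subalg_gen G F -> subalg_gen G (c *: F).
Proof. by move=> GF; rewrite -mulr_algl; apply: Subalg_mul => //;
  apply: Subalg_scalar. Qed.

Lemma subalg_genB F F' : subalg_gen G F -> subalg_gen G F' -> subalg_gen G (F -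
  F').
Proof. by move=> GF GF'; apply: Subalg_add => //; rewrite -scaleN1r;
  apply: subalg_genZ. Qed.

Lemma subalg_gen_sum (I : finType) (F : I -> A) :
  (forall i, subalg_gen G (F i)) -> subalg_gen G (\sum_i F i).
Proof.
move=> GF; apply: (big_ind (subalg_gen G)) => //; last exact: Subalg_add.
by rewrite -(scale0r 1); apply: Subalg_scalar.
Qed.

End Subalgebra.

Section Pencil.
Variables (K : fieldType) (q : lieAlgType K) (B : {symmetric q}).
Variables (d : nat) (x : d.-tuple q).
Hypothesis xbasis : basis_of fullv x.
Hypothesis xortho : forall i j : 'I_d, B x`_i x`_j = (i == j)%:R.
Hypothesis Binv : forall w y z, B (lie w y) z + B y (lie w z) = 0.
Hypothesis two : 2%:R != 0 :> K.
Variables (n : nat) (n_ge2 : (2 <= n)%N) (a : 'I_n -> K).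
Hypothesis a_inj : injective a.
Let p : {poly K} := \prod_i ('X - (a i)%:P).
Let r (i : 'I_n) := lagrange_basis p a i.

Notation W := (sym K ('I_d * 'I_n)%type).

Lemma size_prod_roots : size p = n.+1.
Proof. by rewrite size_prod_XsubC -[index_enum _]enumT size_enum_ord. Qed.

(** Multiplication by t^m is the scalar a_i^m on r_i, so it may be moved between the two arguments
    and the bracket cancels. *)
Lemma Zquot_lagrange i : Zquot x p (hbar x n p (r i) (r i)).
Proof.
apply: poisson_centerP; first exact: bracketW_anti.
move=> u; rewrite (sderiv_hbar xbasis xortho Binv size_prod_roots).
have e_dvdp (j : 'I_d) s : p %| s -> barWl x p n x`_j s = 0 by apply: barW_dvdp.
rewrite (bil_lagrange_shift e_dvdp a_inj (erefl p) (str B x u.1) u.2 i).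
exact: subrr.
Qed.

(* The h[r_i, r_i] are the Casimir elements of the summands q r_i of W.       *)
Lemma gaudin_lagrange l (S : nat -> nat -> K) k :
  let s i j := \sum_(b < l) \sum_(c < l) S b c * (a i ^+ b * a j ^+ c) in
  (forall i j, i != j -> i != k -> j != k -> s i j = 0) ->
  (forall j, j != k -> s k j + s j k = ((a k)^-1 - (a j)^-1)^-1) ->
  \sum_(b < l) \sum_(c < l) S b c *: hbar x n p 'X^b 'X^c
    = \sum_i s i i *: hbar x n p (r i) (r i)
      + gaudin x p a (fun i => (a i)^-1) k.
Proof.
move=> s s0 sk.
have e_dvdp (j : 'I_d) t : p %| t -> barWl x p n x`_j t = 0 by apply: barW_dvdp.
have h_sym i j : hbar x n p (r i) (r j) = hbar x n p (r j) (r i).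
  by apply: eq_bigr => m _; apply: mulrC.
rewrite -(sum_star h_sym s0 sk).
pose M (j m : 'I_d) : K := (m == j)%:R; pose e (j : 'I_d) := barWl x p n x`_j.
transitivity (\sum_(b < l) \sum_(c < l) S b c *: bil e M 'X^b 'X^c).
  by apply: eq_bigr => b _; apply: eq_bigr => c _; rewrite hbarE.
rewrite (sum_bil_lagrange e_dvdp a_inj (erefl p)).
by apply: eq_bigr => i _; apply: eq_bigr => j _; rewrite hbarE.
Qed.

Hypothesis p0 : p.[0] != 0.

Lemma root_neq0 i : a i != 0.
Proof.
apply: contraNneq p0 => ai; rewrite horner_prod (bigD1 i) //= hornerXsubC.
by rewrite ai subrr mul0r.
Qed.

Lemma Zquot_sol (f : {poly K}) : (size f <= n)%N -> Zquot x p (hquad d n (sol p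
  f 0)).
Proof.
move=> sf; have s0 : (size (0%R : {poly K}) <= n)%N by rewrite size_poly0.
apply: (Zquot_hquad xbasis xortho Binv size_prod_roots (leqW sf)).
  exact: (sol_supp two size_prod_roots n_ge2 sf s0).
move=> b c; rewrite sol_mul // /sol_rhs /wedge !coef0 !mulr0 subr0.
by rewrite addr0.
Qed.

(** With equal parameters the two wedges add up to [wedge (p + 'X) f], so the array is a central
    solution for p + t. *)
Lemma Zquot_sol_shift (f : {poly K}) : (size f <= n)%N ->
  Zquot x (p + 'X) (hquad d n (sol p f f)).
Proof.
move=> sf; have size_pX : size (p + 'X) = n.+1.
  by rewrite size_polyDl size_prod_roots // size_polyX.
apply: (Zquot_hquad xbasis xortho Binv size_pX (leqW sf)).
  exact: (sol_supp two size_prod_roots n_ge2 sf sf).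
by move=> b c; rewrite sol_mul // /sol_rhs /wedge !coefD; ring.
Qed.

Lemma Zpencil_gaudin k : Zpencil x p (p + 'X) (gaudin x p a (fun i => (a i)^-1)
  k).
Proof.
(* Only pairs containing k survive; s k j and s j k both equal a_k a_j / (2 (a_j - a_k)) and add up
   to 1 / (1/a_k - 1/a_j). *)
pose f := (a k / 2%:R) *: r k.
have sr : (size (r k) <= n)%N by apply: (size_lagrange_basis size_prod_roots).
have sf : (size f <= n)%N by apply: leq_trans (size_scale_leq _ _) sr.
have s0 : (size (0%R : {poly K}) <= n)%N by rewrite size_poly0.
have fE i : f.[a i] = a k / 2%:R * (i == k)%:R.
  by rewrite hornerZ (lagrange_horner a_inj (erefl p)).
pose S := sol p 0 f.
pose s i j := \sum_(b < n) \sum_(c < n) S b c * (a i ^+ b * a j ^+ c).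
have sE i j : (a i - a j) * s i j = a i * f.[a j] - a j * f.[a i].
  rewrite (xy_mul_horner _ _ (sol_supp two size_prod_roots n_ge2 s0 sf)).
  have sX : (size ('X : {poly K}) <= n.+1)%N by rewrite size_polyX ltnS ltnW.
  have := wedge_horner (a i) (a j) sX (leqW sf); rewrite !hornerX => <-.
  apply: eq_bigr => b _; apply: eq_bigr => c _; congr (_ * _).
  by rewrite sol_mul // /sol_rhs /wedge !coef0 !mulr0 subr0 add0r.
have sub_neq0 i j : i != j -> a i - a j != 0 by rewrite subr_eq0 (inj_eq a_inj).
have sol_expand : hquad d n S = \sum_i s i i *: hbar x n p (r i) (r i)
      + gaudin x p a (fun i => (a i)^-1) k.
  rewrite -(gaudin_lagrange (S := S) (l := n)).
  - apply: eq_bigr => b _; apply: eq_bigr => c _.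
    by rewrite (hbar_hmon xbasis size_prod_roots).
  - move=> i j ij ik jk; apply: (mulfI (sub_neq0 _ _ ij)).
    by rewrite mulr0 [LHS]sE !fE (negPf ik) (negPf jk) !mulr0 subrr.
  move=> j jk; rewrite -/(s k j) -/(s j k).
  have jk' := sub_neq0 _ _ jk; have ak := root_neq0 k; have aj := root_neq0 j.
  have kj' : a k - a j != 0 by rewrite -opprB oppr_eq0.
  have -> : s k j = - (a j * (a k / 2%:R)) / (a k - a j).
    apply: (mulfI kj'); rewrite [LHS]sE !fE (negPf jk) eqxx mulr0 mulr1 mulr0
      sub0r.
    by rewrite [RHS]mulrC divfK.
  have -> : s j k = (a j * (a k / 2%:R)) / (a j - a k).
    apply: (mulfI jk'); rewrite [LHS]sE !fE (negPf jk) eqxx mulr0 mulr1 mulr0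
      subr0.
    by rewrite [RHS]mulrC divfK.
  by field; rewrite mulN1r two ak aj jk' kj'.
have -> : gaudin x p a (fun i => (a i)^-1) k
    = hquad d n (sol p f f) - hquad d n (sol p f 0)
      - \sum_i s i i *: hbar x n p (r i) (r i).
  have <- : hquad d n S = hquad d n (sol p f f) - hquad d n (sol p f 0).
    rewrite [RHS]addrC -scaleN1r -hquad_linear; apply: eq_hquad => b c.
    by rewrite -sol_linear !scaleN1r addNr oppr0 add0r.
  by rewrite sol_expand addrAC subrr add0r.
apply: subalg_genB; first apply: subalg_genB.
(* The member of the pencil at 0 is p + t, and the one at 1 is p. *)
- apply: Subalg_gen; exists 0; rewrite scale0r subr0 scale1r add0r.
  exact: Zquot_sol_shift.
- apply: Subalg_gen; exists 1; rewrite scale1r subrr scale0r addr0.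
  exact: Zquot_sol.
apply: subalg_gen_sum => i; apply: subalg_genZ; apply: Subalg_gen; exists 1.
by rewrite scale1r subrr scale0r addr0; apply: Zquot_lagrange.
Qed.

End Pencil.

(** * Invariants of the current algebra *)

Section DividedDifference.
Variables (K : fieldType) (phi : {poly K}) (v : K).

(** The divided difference (phi(X) - phi(v)) / (X - v). *)
Definition ddiff : {poly K} :=
  \sum_(b < size phi) \sum_(c < size phi) phi`_(b + c).+1 *: (v ^+ c *: 'X^b).

(** The array phi_(b + c + 1) is constant on antidiagonals, so multiplication by x - y leaves only
    row 0 and column 0. *)
Lemma ddiffE : ('X - v%:P) * ddiff = phi - (phi.[v])%:P.
Proof.
pose S b c := phi`_(b + c).+1.
have S0 b c : (size phi <= b)%N || (size phi <= c)%N -> S b c = 0.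
  move=> le; rewrite /S nth_default // leqW //.
  by case/orP: le => le; apply: leq_trans le _; rewrite ?leq_addr ?leq_addl.
have := xy_mul_sum (fun b c => v ^+ c *: ('X^b : {poly K})) S0.
have -> : \sum_(b < size phi) \sum_(c < size phi)
    S b c *: (v ^+ c *: 'X^(b.+1) - v ^+ c.+1 *: 'X^b) = ('X - v%:P) * ddiff.
  rewrite mulr_sumr; apply: eq_bigr => b _; rewrite mulr_sumr;
    apply: eq_bigr => c _.
  rewrite -scalerAr; congr (_ *: _); rewrite -scalerAr mulrBl scalerBr exprS.
  by rewrite mul_polyC scalerA -exprSr.
move->; have le : (size phi <= (size phi).+1)%N by [].
have phiX : phi = (phi`_0)%:P + \sum_(b < size phi) phi`_b.+1 *: 'X^(b.+1).
  rewrite -[LHS]coefK (@poly_def _ (size phi)) (big_ord_widen _ (fun b =>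
    phi`_b *: 'X^b) le).
  rewrite big_mkcond big_ord_recl /= expr0 alg_polyC; congr (_ + _).
    by case: ltnP => //; rewrite leqn0 size_poly_eq0 => /eqP->; rewrite coef0.
  apply: eq_bigr => b _; rewrite -[bump 0 b]/b.+1.
  by case: ltnP => // ge; rewrite nth_default // scale0r.
have phiv : phi.[v] = phi`_0 + \sum_(c < size phi) phi`_c.+1 * v ^+ c.+1.
  by rewrite (horner_coef_wide _ le) big_ord_recl /= expr0 mulr1.
rewrite phiv [X in _ = X - _]phiX polyCD opprD addrACA subrr add0r rmorph_sum
  big_ord_recl big_ord_recl /=.
rewrite {1}/xy_mul subrr scale0r add0r [LHS]addrC; congr (_ + _).
  apply: eq_bigr => b _; rewrite big_ord_recl big1 ?addr0 => [|c _].
    by rewrite /xy_mul /= subr0 /S addn0 expr0 scale1r.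
  by rewrite /xy_mul /= /S -[bump 0 c]/c.+1 addnS subrr scale0r.
rewrite -sumrN; apply: eq_bigr => c _.
by rewrite /xy_mul /= sub0r /S add0n scaleNr scalerA alg_polyC.
Qed.

End DividedDifference.

Section Shift.
Variables (K : fieldType) (V : lmodType K).

Lemma sum_shift (h : nat -> V) L k :
  (forall b, (b < k)%N -> h b = 0) -> (forall b, (L <= b)%N -> h b = 0) ->
  \sum_(b < L) h b = \sum_(b < L) h (b + k)%N.
Proof.
move=> hk hL; transitivity (\sum_(i < k + L) h i).
  rewrite addnC big_split_ord /= [X in _ = _ + X]big1 ?addr0 // => b _.
  by rewrite hL // leq_addr.
rewrite big_split_ord /= [X in X + _]big1 ?add0r => [|b _]; last by rewrite hk.
by apply: eq_bigr => b _; rewrite addnC.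
Qed.

End Shift.

Section CurrentInvariance.
Variables (K : fieldType) (A : comAlgType K) (d : nat).
Variables (X : 'I_d -> nat -> A) (M : 'I_d -> 'I_d -> K) (phi : nat -> K) (L k
  : nat).
Hypothesis M_anti : forall j m, M j m = - M m j.
Hypothesis phi_supp : forall b, (L <= b)%N -> phi b = 0.
Hypothesis two : 2%:R != 0 :> K.

(** The action of t^k on t^(-b-1): level b goes to b - k, or to 0 in the quotient once the exponent
    is nonnegative. *)
Let Y m b : A := if (k <= b)%N then X m (b - k)%N else 0.

(** The coefficients depend only on b + c. After shifting b by k, a symmetric array is paired with
    the antisymmetric M, so the sum equals its negative. *)
Lemma current_invariance :
  \sum_(b < L) \sum_(c < L) phi (b + c).+1 *:
     (\sum_j ((\sum_m M j m *: Y m b) * X j c + X j b * (\sum_m M j m *: Y m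
       c))) = 0.
Proof.
pose Theta b c := \sum_j \sum_m M j m *: (X m b * X j c).
pose Psi b c := \sum_j \sum_m M j m *: (Y m b * X j c).
have Theta_anti b c : Theta b c = - Theta c b.
  rewrite /Theta exchange_big -sumrN; apply: eq_bigr => m _.
  rewrite -sumrN; apply: eq_bigr => j _.
  by rewrite M_anti scaleNr mulrC.
have splitE b c : \sum_j ((\sum_m M j m *: Y m b) * X j c + X j b * (\sum_m M j
  m *: Y m c))
    = Psi b c + Psi c b.
  rewrite big_split; congr (_ + _); apply: eq_bigr => j _.
    by rewrite mulr_suml; apply: eq_bigr => m _; rewrite scalerAl.
  by rewrite mulrC mulr_suml; apply: eq_bigr => m _; rewrite scalerAl.
pose Z := \sum_(b < L) \sum_(c < L) phi (b + c).+1 *: Psi b c.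
have ZE : Z = \sum_(c < L) \sum_(b < L) phi (b + k + c).+1 *: Theta b c.
  rewrite /Z exchange_big; apply: eq_bigr => c _.
  rewrite (sum_shift (h := fun b => phi (b + c).+1 *: Psi b c) (k := k)) => [|b
    bk|b Lb].
  - apply: eq_bigr => b _; congr (_ *: _); apply: eq_bigr => j _.
    by apply: eq_bigr => m _; rewrite /Y leq_addl addnK.
  - rewrite /Psi big1 ?scaler0 // => j _; rewrite big1 // => m _.
    by rewrite /Y leqNgt bk mul0r scaler0.
  by rewrite phi_supp ?scale0r // ltnW // ltnS (leq_trans Lb) // leq_addr.
have Z0 : Z = 0.
  apply: (eqN_eq0 two); rewrite ZE [LHS]exchange_big -sumrN;
    apply: eq_bigr => b _.
  rewrite -sumrN; apply: eq_bigr => c _; rewrite Theta_anti scalerN;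
    congr (- (phi _.+1 *: _)).
  by lia.
transitivity (Z + \sum_(b < L) \sum_(c < L) phi (b + c).+1 *: Psi c b).
  rewrite -big_split; apply: eq_bigr => b _; rewrite -big_split.
  by apply: eq_bigr => c _; rewrite splitE scalerDr.
rewrite Z0 add0r -[RHS]Z0 exchange_big; apply: eq_bigr => b _.
by apply: eq_bigr => c _; rewrite addnC.
Qed.

End CurrentInvariance.

Section CurrentAlgebra.
Variables (K : fieldType) (q : lieAlgType K) (B : {symmetric q}).
Variables (d : nat) (x : d.-tuple q).
Hypothesis xbasis : basis_of fullv x.
Hypothesis xortho : forall i j : 'I_d, B x`_i x`_j = (i == j)%:R.
Hypothesis Binv : forall w y z, B (lie w y) z + B y (lie w z) = 0.
Hypothesis two : 2%:R != 0 :> K.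

(* For phi = t^m, with the variable (j, b) standing for x_j t^(-b-1), this is *)
(* the sum of the h[-u, -v] over u + v = m + 1, u, v >= 1.                    *)
Definition segal (phi : {poly K}) : sym K ('I_d * nat)%type :=
  \sum_(b < size phi) \sum_(c < size phi)
    phi`_(b + c).+1 *: \sum_j svar K (j, b : nat) * svar K (j, c : nat).

Lemma seval_segal (A : comAlgType K) (f : 'I_d * nat -> A) phi :
  seval f (segal phi) = \sum_(b < size phi) \sum_(c < size phi)
    phi`_(b + c).+1 *: \sum_j f (j, b : nat) * f (j, c : nat).
Proof.
rewrite linear_sum; apply: eq_bigr => b _; rewrite linear_sum.
apply: eq_bigr => c _; rewrite linearZ; congr (_ *: _); rewrite linear_sum.
apply: eq_bigr => j _; apply: etrans (rmorphM (seval f) _ _) _.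
by rewrite -(seval_svar f (j, b : nat)) -(seval_svar f (j, c : nat)).
Qed.

Lemma Zhat_neg_segal phi : Zhat_neg x (segal phi).
Proof.
move=> y k.
pose nproj : {lrmorphism sym K ('I_d * int)%type -> sym K ('I_d * nat)%type} :=
  seval (fun v : 'I_d * int => if v.2 is Negz k then svar K (v.1, k) else 0).
pose D i := sderiv (loop_bracket x (i, k%:Z)).
suff D0 i : nproj (D i (neg_incl (segal phi))) = 0.
  rewrite /poisson linear_sum; apply: etrans (linear_sum nproj _ _ _) _.
  apply: big1 => i _; apply: etrans (congr1 nproj (linearZ _ _)) _.
  apply: etrans (linearZ _ _) _.
  exact: (etrans (congr1 (GRing.scale _) (etrans (congr1 nproj (sderiv_svar _
    _)) (D0 i)))
    (scaler0 _ _)).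
pose X (m : 'I_d) (b : nat) := svar K (m, b).
pose Y m b := if (k <= b)%N then X m (b - k)%N else 0.
have nprojX m b : nproj (svar K (m, Negz b)) = X m b by apply: seval_svar.
have nprojY j b : nproj (loop_bracket x (i, k%:Z) (j, Negz b))
    = \sum_m str B x i j m *: Y m b.
  rewrite linear_sum; apply: eq_bigr => m _;
    rewrite linearZ (coordE xbasis xortho).
  congr (_ *: _); apply: etrans (seval_svar _ _) _; rewrite /= /Y leqNgt.
  (* Addition of integers computes here: k - b - 1 is negative exactly when k <= b. *)
  have -> : k%:Z + Negz b = if (b < k)%N then Posz (k - b.+1) else Negz (b - k)
    by [].
  by case: ltnP.
have phi0 b : (size phi <= b)%N -> phi`_b = 0 by move=> le; rewrite nth_default.
rewrite -[RHS](current_invariance X k (str_antir x Binv i) phi0 two).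
rewrite /neg_incl seval_segal.
apply: etrans (congr1 nproj (linear_sum _ _ _ _)) _;
  apply: etrans (linear_sum nproj _ _ _) _.
apply: eq_bigr => b _.
apply: etrans (congr1 nproj (linear_sum _ _ _ _)) _;
  apply: etrans (linear_sum nproj _ _ _) _.
apply: eq_bigr => c _.
apply: etrans (congr1 nproj (linearZ _ _)) _; apply: etrans (linearZ _ _) _.
congr (_ *: _).
apply: etrans (congr1 nproj (linear_sum _ _ _ _)) _;
  apply: etrans (linear_sum nproj _ _ _) _.
apply: eq_bigr => j _; apply: etrans (congr1 nproj (sderivM _ _ _)) _.
apply: etrans (rmorphD nproj _ _) _.
apply: etrans (f_equal2 +%R (rmorphM nproj _ _) (rmorphM nproj _ _)) _.
have Dv m (b' : nat) : nproj (D i (svar K (m, Negz b'))) = \sum_l str B x i m l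
  *: Y l b'.
  by rewrite -nprojY; congr (nproj _); apply: sderiv_svar.
exact: (f_equal2 +%R (f_equal2 *%R (Dv j b) (nprojX j c))
  (f_equal2 *%R (nprojX j b) (Dv j c))).
Qed.

End CurrentAlgebra.

Lemma ddiff_horner (K : fieldType) (phi : {poly K}) u v :
  (u - v) * (ddiff phi v).[u] = phi.[u] - phi.[v].
Proof.
have := congr1 (fun f : {poly K} => f.[u]) (ddiffE phi v).
by rewrite hornerM hornerXsubC hornerD hornerN hornerC.
Qed.

Lemma ddiff_deriv (K : fieldType) (phi : {poly K}) u : (ddiff phi u).[u] =
  phi^`().[u].
Proof.
have := congr1 (fun f : {poly K} => f^`().[u]) (ddiffE phi u).
rewrite derivM derivXsubC mul1r derivB derivC subr0 hornerD hornerM hornerXsubC.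
by rewrite subrr mul0r addr0.
Qed.

(** The coefficients of xy (phi(x) - phi(y)) / (x - y): level b stands for t^(b+1) after the
    substitution, which shifts both indices by one. *)
Definition segal_coef (K : fieldType) (phi : {poly K}) (b c : nat) : K :=
  if b is b'.+1 then if c is c'.+1 then phi`_(b' + c').+1 else 0 else 0.

Lemma sum_segal_coef (K : fieldType) (V : lmodType K) (phi : {poly K}) (h : nat
  -> nat -> V) :
  \sum_(b < (size phi).+1) \sum_(c < (size phi).+1) segal_coef phi b c *: h b c
    = \sum_(b < size phi) \sum_(c < size phi) phi`_(b + c).+1 *: h b.+1 c.+1.
Proof.
rewrite big_ord_recl big1 ?add0r => [|c _]; last by rewrite scale0r.
by apply: eq_bigr => b _; rewrite big_ord_recl scale0r add0r.
Qed.

Lemma segal_coef_horner (K : fieldType) (phi : {poly K}) u v :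
  \sum_(b < (size phi).+1) \sum_(c < (size phi).+1)
     segal_coef phi b c * (u ^+ b * v ^+ c) = u * v * (ddiff phi v).[u].
Proof.
rewrite (sum_segal_coef (V := K^o) phi (fun b c => u ^+ b * v ^+ c)) horner_sum
  mulr_sumr.
apply: eq_bigr => b _; rewrite horner_sum mulr_sumr; apply: eq_bigr => c _.
by rewrite !hornerZ hornerXn !exprS /GRing.scale /=; ring.
Qed.

(** * Gaudin Hamiltonians as images of Segal-Sugawara elements *)

Section Gaudin.
Variables (K : fieldType) (q : lieAlgType K) (B : {symmetric q}).
Variables (d : nat) (x : d.-tuple q).
Hypothesis xbasis : basis_of fullv x.
Hypothesis xortho : forall i j : 'I_d, B x`_i x`_j = (i == j)%:R.
Hypothesis Binv : forall w y z, B (lie w y) z + B y (lie w z) = 0.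
Hypothesis two : 2%:R != 0 :> K.
Variables (n : nat) (a : 'I_n -> K).
Hypothesis a_inj : injective a.
Let p : {poly K} := \prod_i ('X - (a i)%:P).
Hypothesis p0 : p.[0] != 0.

Definition segal_cur (phi : {poly K}) : sym K ('I_d * nat)%type :=
  seval (fun v : 'I_d * nat => svar K (v.1, v.2.+1)) (segal d phi).

Lemma psi_segal phi :
  psi x n p (segal_cur phi) = \sum_(b < (size phi).+1) \sum_(c < (size phi).+1)
     segal_coef phi b c *: hbar x n p 'X^b 'X^c.
Proof.
rewrite (sum_segal_coef phi (fun b c => hbar x n p 'X^b 'X^c)).
pose ps : {lrmorphism sym K ('I_d * nat)%type -> sym K ('I_d * 'I_n)%type} :=
  seval (fun v : 'I_d * nat => barW x n p x`_v.1 'X^(v.2)).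
apply: etrans (seval_comp ps _ _) _; apply: etrans (seval_segal _ _) _.
apply: eq_bigr => b _; apply: eq_bigr => c _.
apply: (congr1 (GRing.scale _)); apply: eq_bigr => j _.
exact: (f_equal2 *%R (seval_svar _ _) (seval_svar _ _)).
Qed.

(** The image of [segal_cur phi] has coefficients a_i a_j (phi(a_i) - phi(a_j)) / (a_i - a_j) off
    the diagonal and a_i^2 phi'(a_i) on it. The value -1/2 at a_k and 0 at the other roots gives
    H_k, opposite entries adding up; zero derivatives remove the Casimir terms. *)
Lemma Zhat_gaudin k :
  exists2 F, Zhat x F & psi x n p F = gaudin x p a (fun i => (a i)^-1) k.
Proof.
have [r rE] : exists r : {poly K}, forall i, r.[a i] = (i == k)%:R.
  by exists (lagrange_basis p a k) => i; apply: lagrange_horner.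
(* 3 r^2 - 2 r^3 takes the same values as r at the a_i, where its derivative  *)
(* vanishes.                                                                  *)
pose phi := (- 2%:R^-1) *: (3%:R *: (r * r) - 2%:R *: (r * r * r)).
exists (segal_cur phi).
  by exists (segal d phi) => //;
    apply: Zhat_neg_segal xbasis xortho Binv two phi.
have phiE i : phi.[a i] = - 2%:R^-1 * (i == k)%:R.
  by rewrite /phi !(hornerZ, hornerD, hornerN, hornerM) !rE;
    case: (i == k) => /=; field.
have dphi i : phi^`().[a i] = 0.
  rewrite /phi derivZ derivB !derivZ !derivM !(hornerZ, hornerD, hornerN,
    hornerM) !rE.
  by case: (i == k) => /=; ring.
rewrite psi_segal.
pose s i j := \sum_(b < (size phi).+1) \sum_(c < (size phi).+1)
  segal_coef phi b c * (a i ^+ b * a j ^+ c).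
have sE i j : (a i - a j) * s i j = a i * a j * (phi.[a i] - phi.[a j]).
  by rewrite /s segal_coef_horner mulrCA ddiff_horner.
have sub_neq0 i j : i != j -> a i - a j != 0 by rewrite subr_eq0 (inj_eq a_inj).
rewrite (gaudin_lagrange x a_inj (S := segal_coef phi) (k := k)).
- rewrite big1 ?add0r // => i _;
  rewrite segal_coef_horner ddiff_deriv dphi mulr0.
  exact: scale0r.
- move=> i j ij ik jk; apply: (mulfI (sub_neq0 _ _ ij)).
  by rewrite mulr0 [LHS]sE !phiE (negPf ik) (negPf jk) subrr mulr0.
- move=> j jk; rewrite -/(s k j) -/(s j k).
  have jk' := sub_neq0 _ _ jk; have ak := root_neq0 p0 k;
    have aj := root_neq0 p0 j.
  have kj' : a k - a j != 0 by rewrite -opprB oppr_eq0.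
  have -> : s k j = - (a k * a j / 2%:R) / (a k - a j).
    apply: (mulfI kj'); rewrite [LHS]sE !phiE (negPf jk) eqxx [RHS]mulrC divfK
      //.
    by rewrite mulr0 mulr1 subr0 mulrN.
  have -> : s j k = (a k * a j / 2%:R) / (a j - a k).
    apply: (mulfI jk'); rewrite [LHS]sE !phiE (negPf jk) eqxx [RHS]mulrC divfK
      //.
    by rewrite mulr0 mulr1 sub0r opprK [a j * _]mulrC.
  by field; rewrite mulN1r two ak aj jk' kj'.
Qed.

End Gaudin.

Theorem theorem4p12 (K : closedFieldType) (charK : [pchar K] =i pred0)
  (N : nat) (Q : 'M[K]_N -> Prop) (algQ : algebraic_group Q)
  (q : lieAlgType K) (iota : {linear q -> 'M[K]_N}) (LieQ : Lie_iso Q iota)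
  (B : {symmetric q}) (Bnd : nondegenerate B) (BinvQ : Ad_invariant Q iota B)
  (d : nat) (x : d.-tuple q) (xbasis : basis_of fullv x)
  (xortho : forall i j : 'I_d, B x`_i x`_j = (i == j)%:R)
  (qnab : exists y z : q, lie y z != 0)
  (n : nat) (n_ge2 : (2 <= n)%N) :
  (forall p : {poly K}, p \is monic -> size p = n.+1 ->
     has_dim (Ph x (Ordinal n_ge2) p) (2 * n - 1)) /\
  (forall (p : {poly K}) (a : 'I_n -> K),
     injective a -> p = \prod_(i < n) ('X - (a i)%:P) -> p.[0] != 0 ->
     forall k : 'I_n,
       (exists2 F, Zhat x F & psi x n p F = gaudin x p a (fun i => (a i)^-1) k)
         /\
       Zpencil x p (p + 'X) (gaudin x p a (fun i => (a i)^-1) k)).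
Proof.
have two := char0_two charK.
have Binv := lie_invariant algQ LieQ BinvQ.
split=> [p p_monic size_prod_roots|p a a_inj -> p0 k].
  exact: (dim_Ph xbasis xortho Binv two qnab size_prod_roots p_monic).
split; first exact: (Zhat_gaudin xbasis xortho Binv two a_inj p0 k).
exact: (Zpencil_gaudin xbasis xortho Binv two n_ge2 a_inj p0 k).
Qed.
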